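(* Let $k>0$ be a real number. Let $a,b,\psi$ be holomorphic functions on some neighborhood $[-1,1]_\mu$ ($\mu>0$) of $[-1,1]$ such that $\psi$ verifies the $E(k)$ property. Let $d\in[-1,1]$ and $c\in\mathbb{R}$ be given numbers, and let $P(x)=\sum_{j=0}^{N_0}a_jx^j$ be a polynomial function with real coefficients and degree $N_0\ge 2$, with associated polynomial $\underline{P}(x)=\sum_{j=1}^{N_0}|a_j|x^j$. Assume that $$\|a\|_1\,\underline{P}'(0)<1,$$ let $\theta(P,a)$ denote the unique strictly positive root $r$ of the equation $\|a\|_1\,\underline{P}'(r)=1$, and assume in addition that $$0<\|b+P(0)a\|_1+|c|<\theta(P,a)-\frac{\underline{P}(\theta(P,a))}{\underline{P}'(\theta(P,a))}.$$ Then the functional differential equation $$y'(x)=a(x)\,P\big(y(\psi(x))\big)+b(x),\qquad x\in[-1,1],$$ has a solution $u_{d,c}$ which belongs to the Gevrey class $G_k([-1,1])$ and verifies the initial condition $u_{d,c}(d)=c$.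
   Context: For $r>0$, $[-1,1]_r:=[-1,1]+B(0,r)=\{x+w: x\in[-1,1],\ w\in\mathbb{C},\ |w|<r\}$, an open neighborhood of $[-1,1]$ in $\mathbb{C}$. For $k,A>0$ and an integer $n\ge1$, $[-1,1]_{k,A,n}:=[-1,1]+B(0,An^{-1/k})$. For a function $g$ whose domain contains $[-1,1]$ and which is continuous on $[-1,1]$, $\|g\|_1:=\int_{-1}^1|g(t)|\,dt$. For a bounded function $f$ on $[-1,1]$, $\|f\|_{\infty,[-1,1]}:=\sup_{u\in[-1,1]}|f(u)|$. $E(k)$ property: a holomorphic function $\varphi$ on a neighborhood $[-1,1]_r$ of $[-1,1]$ ($r>0$) verifies the $E(k)$ property if there exists a constant $\tau_\varphi\in\,]0,r]$, depending only on $\varphi$, such that for all $A\in\,]0,\tau_\varphi]$ there exists an integer $N(A)\ge1$, depending only on $A$, such that for every integer $p\ge N(A)$ one has $\varphi([-1,1]_{k,A,p+1})\subset[-1,1]_{k,A,p}$. (This implies $\varphi([-1,1])\subset[-1,1]$, so that $y(\psi(x))$ makes sense for $x\in[-1,1]$.) Gevrey class: $G_k([-1,1])$ is the set of all functions $f$ of class $C^\infty$ on $[-1,1]$ (complex values are allowed, since $a$ and $b$ may be complex-valued on $[-1,1]$) for which there exists a constant $B>0$ such that $\|f^{(n)}\|_{\infty,[-1,1]}\le B^{n+1}n^{n(1+1/k)}$ for all $n\in\mathbb{N}=\{0,1,2,\dots\}$, with the convention $0^0=1$. *)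

(* Defs.v *)
From Stdlib Require Import Reals Lra Lia.
From Coquelicot Require Import Coquelicot.

Local Open Scope R_scope.

Definition seg (x : R) : Prop := -1 <= x <= 1.

Definition seg_nbhd (r : R) (z : C) : Prop :=
  exists (x : R) (w : C), seg x /\ Cmod w < r /\ z = Cplus (RtoC x) w.

Definition seg_nbhd_k (k A : R) (n : nat) : C -> Prop :=
  seg_nbhd (A * Rpower (INR n) (- (1 / k))).

Definition holomorphic_on (U : C -> Prop) (f : C -> C) : Prop :=
  forall z : C, U z -> ex_derive (K := C_AbsRing) (V := C_NormedModule) f z.

Definition norm1 (g : C -> C) : R := RInt (fun t : R => Cmod (g (RtoC t))) (-1) 1.

(* Valued in [Rbar], so that it is [p_infty] when [f] is unbounded on [-1, 1]. *)
Definition sup_norm (f : R -> C) : Rbar :=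
  Lub_Rbar (fun v : R => exists u : R, seg u /\ v = Cmod (f u)).

Definition E_property (k r : R) (phi : C -> C) : Prop :=
  exists tau : R, 0 < tau <= r /\
    forall A : R, 0 < A <= tau ->
      exists N : nat, (1 <= N)%nat /\
        forall p : nat, (N <= p)%nat ->
          forall z : C, seg_nbhd_k k A (S p) z -> seg_nbhd_k k A p (phi z).

(* Same as [is_derive] for functions of a real variable, except that only points
   of [-1, 1] are considered: the derivative is one-sided at -1 and 1, and the
   values of [f] outside [-1, 1] do not matter. *)
Definition is_derive_seg (f : R -> C) (x : R) (l : C) : Prop :=
  filterdiff (K := R_AbsRing) (U := R_NormedModule) (V := C_R_NormedModule)
    f (within seg (locally x)) (fun h : R => scal h l).

(* [F n] is, on [-1, 1], the n-th derivative of [f]. *)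
Definition is_derive_seq_seg (f : R -> C) (F : nat -> R -> C) : Prop :=
  (forall x : R, seg x -> F O x = f x) /\
  (forall (n : nat) (x : R), seg x -> is_derive_seg (F n) x (F (S n) x)).

(* For n = 0 the factor [Rpower 0 0] is 1, as [Rpower x y] is [exp (y * ln x)]. *)
Definition gevrey (k : R) (f : R -> C) : Prop :=
  exists F : nat -> R -> C, is_derive_seq_seg f F /\
    exists B : R, 0 < B /\
      forall n : nat,
        Rbar_le (sup_norm (F n))
          (B ^ (S n) * Rpower (INR n) (INR n * (1 + 1 / k))).

Definition poly_eval (coef : nat -> R) (N0 : nat) (z : C) : C :=
  sum_n (fun j : nat => Cmult (RtoC (coef j)) (Cpow z j)) N0.

Definition poly_under (coef : nat -> R) (N0 : nat) (x : R) : R :=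
  sum_n_m (fun j : nat => Rabs (coef j) * x ^ j) 1 N0.

(* [psi] maps [-1, 1] into itself when it has the E(k) property (see
   [E_property_seg]), so [Re] only turns the real number [psi x] of type [C] into
   an element of [R]. *)
Definition is_solution (a b psi : C -> C) (P : C -> C) (y : R -> C) : Prop :=
  forall x : R, seg x ->
    is_derive_seg y x
      (Cplus (Cmult (a (RtoC x)) (P (y (Re (psi (RtoC x)))))) (b (RtoC x))).

Lemma seg_nbhd_RtoC (r x : R) : 0 < r -> seg x -> seg_nbhd r (RtoC x).
Proof.
intros Hr Hx; exists x, (RtoC 0); split; [exact Hx|]; split.
- now rewrite Cmod_0.
- now rewrite Cplus_0_r.
Qed.

Lemma E_property_seg (k r : R) (phi : C -> C) (x : R) :
  0 < k -> E_property k r phi -> seg x ->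
  exists t : R, seg t /\ phi (RtoC x) = RtoC t.
Proof.
intros Hk [tau [[Ht _] HE]] Hx.
destruct (HE tau (conj Ht (Rle_refl _))) as [N [HN HEN]].
assert (Hsmall : forall e, 0 < e -> seg_nbhd e (phi (RtoC x))).
{ intros e He.
  destruct (INR_unbounded (Rpower (tau / e) k)) as [m Hm].
  set (p := (N + m)%nat).
  destruct (HEN p ltac:(unfold p; lia) (RtoC x)) as [s [w [Hs [Hw E]]]].
  { apply seg_nbhd_RtoC; [|exact Hx].
    apply Rmult_lt_0_compat; [exact Ht|apply exp_pos]. }
  exists s, w; split; [exact Hs|]; split; [|exact E].
  apply Rlt_trans with (1 := Hw).
  assert (Hp : Rpower (tau / e) k < INR p).
  { apply Rlt_le_trans with (1 := Hm); apply le_INR; unfold p; lia. }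
  assert (Hl : k * ln (tau / e) < ln (INR p)).
  { rewrite <- ln_exp at 1; apply ln_increasing; [apply exp_pos|exact Hp]. }
  assert (Hq : - (1 / k) * ln (INR p) < ln (e / tau)).
  { replace (ln (e / tau)) with (- (1 / k) * (k * ln (tau / e))).
    - apply Rmult_lt_gt_compat_neg_l; [|exact Hl].
      assert (0 < 1 / k) by (apply Rdiv_lt_0_compat; lra); lra.
    - rewrite !ln_div by assumption; field; lra. }
  apply exp_increasing in Hq.
  rewrite exp_ln in Hq by (apply Rdiv_lt_0_compat; assumption).
  unfold Rpower.
  apply Rmult_lt_compat_l with (r := tau) in Hq; [|exact Ht].
  now replace (tau * (e / tau)) with e in Hq by (field; lra). }
assert (Hre : forall e, 0 < e -> -1 - e <= Re (phi (RtoC x)) <= 1 + e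
                              /\ Rabs (Im (phi (RtoC x))) <= e).
{ intros e He; destruct (Hsmall e He) as [s [w [Hs [Hw ->]]]].
  pose proof (Rmax_Cmod w) as Hm.
  pose proof (Rmax_l (Rabs (fst w)) (Rabs (snd w))).
  pose proof (Rmax_r (Rabs (fst w)) (Rabs (snd w))).
  pose proof (Rle_abs (fst w)); pose proof (Rle_abs (- fst w)).
  rewrite Rabs_Ropp in *; unfold seg in Hs; simpl; rewrite Rplus_0_l.
  lra. }
exists (Re (phi (RtoC x))); split.
- split; apply le_epsilon; intros e He; destruct (Hre e He); lra.
- apply injective_projections; [reflexivity|].
  change (Im (phi (RtoC x)) = 0).
  apply Rabs_eq_0, Rle_antisym; [|apply Rabs_pos].
  apply le_epsilon; intros e He; destruct (Hre e He); lra.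
Qed.

(* Main.v *)
Require Import Defs.
From Stdlib Require Import Reals Lra Lia Classical ClassicalEpsilon.
From Coquelicot Require Import Coquelicot.

Local Open Scope R_scope.

(** The solution is the limit of the Picard iterates
    f_0 = c,  f_{n+1}(x) = c + int_d^x (a P(f_n o psi) + b),
    but f_n is followed on its own complex neighbourhood U_n of [-1, 1], of
    radius A (p0 + n)^(-1/k).  The E(k) property says precisely that psi maps
    U_{n+1} into U_n, so that f_{n+1} is holomorphic on U_{n+1} when f_n is on
    U_n.  On the interval itself an increment of f_{n+1} is bounded by an
    integral over [-1, 1], which produces the L^1 norms of the hypotheses; the
    step from the interval to a point of U_{n+1} costs only O(A).  If r is
    slightly smaller than theta, the two assumptions become the strict
    inequalities beta + |a|_1 P_(r) < r and |a|_1 P_'(r) < 1, where P_ is the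
    majorant polynomial and beta = |b + P(0) a|_1 + |c| ([choose_radius]).  For
    A small enough they absorb the O(A) terms: all iterates stay in the disc of
    radius r, and |f_{n+1} - f_n| <= 2 r q^n on U_{n+1} for some q < 1
    ([picard_sequence]).

    The Gevrey estimate comes from Cauchy's inequalities for f_{n+1} - f_n in
    discs of radius comparable to A (p0 + n)^(-1/k): the m-th derivative of the
    difference is at most C q^n (B m (p0 + n)^(1/k))^m on [-1, 1].  A part of
    the geometric factor q^n absorbs (p0 + n)^(m/k) up to B^m m^(m/k)
    ([gevrey_term_bound]), and what is left of q^n makes the series over n
    converge, with sum at most B^(m+1) m^(m (1 + 1/k)) ([gevrey_limit]).

    Holomorphy here means complex differentiability at every point, so the
    function theory starts with Goursat's theorem for rectangles ([goursat]),
    proved by bisection.  It has two consequences.  A function holomorphic on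
    [seg_nbhd r] has a primitive there, obtained by integration along a
    horizontal and then a vertical segment ([exists_primitive]); this defines
    f_{n+1}.  Next, for f holomorphic on a closed disc with centre z and radius
    e^s, the function zeta |-> f(z + e^zeta) e^(-zeta) is holomorphic on
    Re zeta <= s and has period 2 i pi, so its integrals over vertical segments of
    length 2 pi do not depend on the abscissa; letting Re zeta tend to -infinity
    gives Cauchy's integral formula for f'(z)
    ([cauchy_formula_derivative]).  Hence |f'(z)| <= M / r when |f| <= M on the
    disc of radius r, and f' is again holomorphic
    ([C_derive_differentiable]).  Applying this first-order inequality m times
    with the radius r / m yields |f^(m)(z)| <= M (m / r)^m, which is within a
    factor e^m of the usual m! M / r^m and therefore good enough for a Gevrey
    class ([C_derive_n_bound]). *)

(** * Complex derivatives and integrals along paths *)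

Notation is_cderive :=
  (is_derive (K := C_AbsRing) (V := C_NormedModule)).
Notation is_rderive :=
  (is_derive (K := R_AbsRing) (V := C_R_NormedModule)).
Notation ccontinuous :=
  (continuous (T := R_UniformSpace) (U := C_R_NormedModule)).
Notation CInt := (RInt (V := C_R_CompleteNormedModule)).
Notation is_CInt := (is_RInt (V := C_R_NormedModule)).
Notation ex_CInt := (ex_RInt (V := C_R_NormedModule)).

Lemma Cmod_opp_minus (x y : C) : Cmod (x - y) = Cmod (y - x).
Proof. rewrite <- Cmod_opp; f_equal; ring. Qed.

Lemma Cmod_minus_ge (x y : C) : Cmod x <= Cmod y + Cmod (x - y).
Proof. replace x with (y + (x - y))%C at 1 by ring; apply Cmod_triangle. Qed.

Lemma Cmod_pair (x y : R) : Cmod (x, y) <= Rabs x + Rabs y.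
Proof.
replace ((x, y) : C) with (RtoC x + Ci * RtoC y)%C
  by (unfold RtoC, Ci, Cplus, Cmult; simpl; f_equal; ring).
eapply Rle_trans; [apply Cmod_triangle|].
rewrite Cmod_mult, !Cmod_R, Cmod_Ci; lra.
Qed.

Lemma im_le_Cmod (z : C) : Rabs (Im z) <= Cmod z.
Proof.
pose proof (Rmax_Cmod z); pose proof (Rmax_r (Rabs (fst z)) (Rabs (snd z))).
unfold Im; lra.
Qed.

Lemma is_cderive_iff (f : C -> C) (z l : C) :
  is_cderive f z l <->
  forall eps, 0 < eps -> exists delta, 0 < delta /\
    forall h, Cmod h < delta -> Cmod (f (z + h)%C - f z - l * h) <= eps * Cmod h.
Proof.
split.
- intros [_ H] eps He.
  destruct (H z (fun P HP => HP) (mkposreal eps He)) as [d Hd].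
  exists d; split; [apply cond_pos|]; intros h Hh.
  specialize (Hd (z + h)%C).
  assert (E : minus (G := C_AbsRing) (z + h)%C z = h)
    by (unfold minus, plus, opp; simpl; ring).
  assert (Hb : ball (M := AbsRing_UniformSpace C_AbsRing) z d (z + h)%C)
    by (unfold ball; simpl; unfold AbsRing_ball; rewrite E; exact Hh).
  assert (Hd' : Cmod (f (z + h)%C - f z - (z + h - z) * l)
                  <= eps * Cmod (z + h - z)) by exact (Hd Hb).
  replace (z + h - z)%C with h in Hd' by ring.
  replace (l * h)%C with (h * l)%C by ring; exact Hd'.
- intros H; split; [apply is_linear_scal_l|].
  intros x Hx; apply (is_filter_lim_locally_unique
    (V := AbsRing_NormedModule C_AbsRing)) in Hx; subst x.
  intros eps; destruct (H eps (cond_pos eps)) as [d [Hd Hd']].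
  exists (mkposreal d Hd); intros y Hy; change C in y.
  specialize (Hd' (y - z)%C Hy).
  replace (z + (y - z))%C with y in Hd' by ring.
  replace (l * (y - z))%C with ((y - z) * l)%C in Hd' by ring.
  exact Hd'.
Qed.

Lemma is_rderive_iff (f : R -> C) (t : R) (l : C) :
  is_rderive f t l <->
  forall eps, 0 < eps -> exists delta, 0 < delta /\
    forall h, Rabs h < delta ->
      Cmod (f (t + h)%R - f t - RtoC h * l) <= eps * Rabs h.
Proof.
split.
- intros [_ H] eps He.
  destruct (H t (fun P HP => HP) (mkposreal eps He)) as [d Hd].
  exists d; split; [apply cond_pos|]; intros h Hh.
  specialize (Hd (t + h)).
  assert (E : minus (G := R_AbsRing) (t + h) t = h)
    by (unfold minus, plus, opp; simpl; ring).
  assert (Hb : ball (M := AbsRing_UniformSpace R_AbsRing) t d (t + h))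
    by (unfold ball; simpl; unfold AbsRing_ball; rewrite E; exact Hh).
  assert (Hd' : norm (V := C_R_NormedModule)
                  (f (t + h)%R - f t - scal (V := C_R_NormedModule) (t + h - t)%R l)%C
                  <= eps * Rabs (t + h - t)) by exact (Hd Hb).
  rewrite <- Cmod_norm, scal_R_Cmult in Hd'.
  replace (t + h - t) with h in Hd' by ring.
  exact Hd'.
- intros H; split; [apply is_linear_scal_l|].
  intros x Hx; apply (is_filter_lim_locally_unique
    (V := AbsRing_NormedModule R_AbsRing)) in Hx; subst x.
  intros eps; destruct (H eps (cond_pos eps)) as [d [Hd Hd']].
  exists (mkposreal d Hd); intros y Hy; change R in y.
  specialize (Hd' (y - t) Hy).
  replace (t + (y - t)) with y in Hd' by ring.
  rewrite <- Cmod_norm, scal_R_Cmult.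
  exact Hd'.
Qed.

(** The filter of the one-sided derivative at [x] has [x] as its only limit
    point, since [x] itself belongs to [-1, 1]; the definition thus comes down to
    a first-order expansion at [x] among the points of the segment. *)
Lemma is_derive_seg_of_bound (f : R -> C) (x : R) (l : C) :
  seg x ->
  (forall eps, 0 < eps -> exists delta, 0 < delta /\
    forall y, seg y -> Rabs (y - x) < delta ->
      Cmod (f y - f x - RtoC (y - x) * l) <= eps * Rabs (y - x)) ->
  is_derive_seg f x l.
Proof.
intros Sx H; split.
{ apply (is_linear_scal_l (K := R_AbsRing) (V := C_R_NormedModule) l). }
intros z Hz.
assert (z = x) as ->.
{ apply eq_close; intros eps.
  destruct (Hz (ball z eps) (locally_ball z eps)) as [d Hd].
  apply (Hd x (ball_center x d) Sx). }
intros eps; destruct (H eps (cond_pos eps)) as [d [Hd Hd']].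
exists (mkposreal d Hd); intros y Hy Sy.
rewrite <- Cmod_norm, scal_R_Cmult.
exact (Hd' y Sy Hy).
Qed.

Lemma ccontinuous_iff (g : R -> C) (t : R) :
  ccontinuous g t <->
  forall eps, 0 < eps -> exists delta, 0 < delta /\
    forall s, Rabs (s - t) < delta -> Cmod (g s - g t) < eps.
Proof.
split.
- intros H eps He.
  assert (Hn : locally_norm (V := C_R_NormedModule) (g t)
                (fun y => Cmod (y - g t) < eps)).
  { exists (mkposreal eps He); intros y Hy.
    unfold ball_norm in Hy; rewrite <- Cmod_norm in Hy; exact Hy. }
  apply locally_le_locally_norm in Hn.
  destruct (H _ Hn) as [d Hd].
  exists d; split; [apply cond_pos|]; intros s Hs; apply (Hd s Hs).
- intros H P HP.
  apply locally_norm_le_locally in HP; destruct HP as [eps HP].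
  destruct (H eps (cond_pos eps)) as [d [Hd Hd']].
  exists (mkposreal d Hd); intros y Hy; apply HP.
  unfold ball_norm; rewrite <- Cmod_norm; exact (Hd' y Hy).
Qed.

Lemma is_cderive_continuous (f : C -> C) (z l : C) :
  is_cderive f z l ->
  forall eps, 0 < eps -> exists delta, 0 < delta /\
    forall h, Cmod h < delta -> Cmod (f (z + h)%C - f z) < eps.
Proof.
intros H eps He.
destruct (proj1 (is_cderive_iff f z l) H 1 Rlt_0_1) as [d [Hd Hd']].
pose proof (Cmod_ge_0 l).
exists (Rmin d (eps / (2 + Cmod l))); split.
{ apply Rmin_pos; [exact Hd|apply Rdiv_lt_0_compat; lra]. }
intros h Hh.
assert (Hh1 : Cmod h < d) by (eapply Rlt_le_trans; [exact Hh|apply Rmin_l]).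
assert (Hh2 : Cmod h < eps / (2 + Cmod l))
  by (eapply Rlt_le_trans; [exact Hh|apply Rmin_r]).
specialize (Hd' h Hh1).
pose proof (Cmod_minus_ge (f (z + h)%C - f z)%C (l * h)%C) as T.
rewrite Cmod_mult in T.
apply Rmult_lt_compat_r with (r := 2 + Cmod l) in Hh2; [|lra].
unfold Rdiv in Hh2; rewrite Rmult_assoc, Rinv_l, Rmult_1_r in Hh2 by lra.
pose proof (Cmod_ge_0 h); nra.
Qed.

(** A path in C is differentiated with respect to a real parameter and the outer
    function with respect to a complex variable, so this chain rule mixes two
    fields of scalars and is proved directly from the expansions. *)
Lemma is_rderive_comp (F : C -> C) (g : R -> C) (t : R) (l v : C) :
  is_cderive F (g t) l -> is_rderive g t v ->
  is_rderive (fun s => F (g s)) t (l * v)%C.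
Proof.
intros HF Hg.
pose proof (proj1 (is_cderive_iff _ _ _) HF) as HF'.
pose proof (proj1 (is_rderive_iff _ _ _) Hg) as Hg'.
apply is_rderive_iff; intros eps He.
pose proof (Cmod_ge_0 l); pose proof (Cmod_ge_0 v).
set (e1 := eps / 2 / (Cmod v + 1)).
assert (He1 : 0 < e1) by (unfold e1; apply Rdiv_lt_0_compat; lra).
destruct (HF' e1 He1) as [d1 [Hd1 HF1]].
set (e2 := Rmin 1 (eps / 2 / (Cmod l + 1))).
assert (He2 : 0 < e2).
{ unfold e2; apply Rmin_pos; [lra|]; apply Rdiv_lt_0_compat; lra. }
destruct (Hg' e2 He2) as [d2 [Hd2 Hg2]].
exists (Rmin d2 (d1 / (Cmod v + 1))); split.
{ apply Rmin_pos; [exact Hd2|]; apply Rdiv_lt_0_compat; lra. }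
intros h Hh.
assert (Hh1 : Rabs h < d2) by (eapply Rlt_le_trans; [exact Hh|apply Rmin_l]).
assert (Hh2 : Rabs h * (Cmod v + 1) < d1).
{ assert (Q : Rabs h < d1 / (Cmod v + 1))
    by (eapply Rlt_le_trans; [exact Hh|apply Rmin_r]).
  apply Rmult_lt_compat_r with (r := Cmod v + 1) in Q; [|lra].
  replace (d1 / (Cmod v + 1) * (Cmod v + 1)) with d1 in Q by (field; lra).
  exact Q. }
specialize (Hg2 h Hh1).
set (k := (g (t + h)%R - g t)%C) in *.
assert (Hk : Cmod k <= Rabs h * (Cmod v + 1)).
{ pose proof (Cmod_minus_ge k (RtoC h * v)%C) as T.
  rewrite Cmod_mult, Cmod_R in T.
  assert (e2 <= 1) by apply Rmin_l.
  pose proof (Rabs_pos h); nra. }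
specialize (HF1 k ltac:(lra)).
replace (g t + k)%C with (g (t + h)%R) in HF1 by (unfold k; ring).
replace (F (g (t + h)%R) - F (g t) - RtoC h * (l * v))%C with
  ((F (g (t + h)%R) - F (g t) - l * k) + l * (k - RtoC h * v))%C by ring.
eapply Rle_trans; [apply Cmod_triangle|]; rewrite Cmod_mult.
assert (A1 : e1 * Cmod k <= eps / 2 * Rabs h).
{ eapply Rle_trans; [apply Rmult_le_compat_l; [lra|exact Hk]|].
  unfold e1; right; field; lra. }
assert (A2 : Cmod l * (e2 * Rabs h) <= eps / 2 * Rabs h).
{ rewrite <- Rmult_assoc; apply Rmult_le_compat_r; [apply Rabs_pos|].
  apply Rle_trans with ((Cmod l + 1) * (eps / 2 / (Cmod l + 1))).
  - apply Rmult_le_compat; try lra; apply Rmin_r.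
  - right; field; lra. }
assert (A3 : Cmod l * Cmod (k - RtoC h * v) <= Cmod l * (e2 * Rabs h))
  by (apply Rmult_le_compat_l; lra).
lra.
Qed.

Lemma is_rderive_affine (z v : C) (t : R) :
  is_rderive (fun s => z + RtoC s * v)%C t v.
Proof.
apply is_rderive_iff; intros eps He; exists 1; split; [lra|]; intros h _.
replace (z + RtoC (t + h) * v - (z + RtoC t * v) - RtoC h * v)%C
  with (RtoC 0) by (rewrite RtoC_plus; ring).
rewrite Cmod_0; apply Rmult_le_pos; [lra|apply Rabs_pos].
Qed.

Lemma is_rderive_hor (y t : R) : is_rderive (fun s => (s, y)) t (RtoC 1).
Proof.
apply is_rderive_iff; intros eps He; exists 1; split; [lra|]; intros h _.
apply Rle_trans with (Cmod (RtoC 0)).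
{ right; f_equal; unfold RtoC, Cminus, Cplus, Copp, Cmult; simpl; f_equal; ring. }
rewrite Cmod_0; apply Rmult_le_pos; [lra|apply Rabs_pos].
Qed.

Lemma is_rderive_ver (x t : R) : is_rderive (fun s => (x, s)) t Ci.
Proof.
apply is_rderive_iff; intros eps He; exists 1; split; [lra|]; intros h _.
apply Rle_trans with (Cmod (RtoC 0)).
{ right; f_equal; unfold RtoC, Ci, Cminus, Cplus, Copp, Cmult; simpl; f_equal; ring. }
rewrite Cmod_0; apply Rmult_le_pos; [lra|apply Rabs_pos].
Qed.

Lemma is_rderive_ccontinuous (g : R -> C) (t : R) (v : C) :
  is_rderive g t v -> ccontinuous g t.
Proof. intros H; apply ex_derive_continuous; exists v; exact H. Qed.

Lemma ccontinuous_mult (f g : R -> C) (t : R) :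
  ccontinuous f t -> ccontinuous g t ->
  ccontinuous (fun s => f s * g s)%C t.
Proof.
intros Hf Hg.
pose proof (proj1 (ccontinuous_iff _ _) Hf) as Hf'.
pose proof (proj1 (ccontinuous_iff _ _) Hg) as Hg'.
apply ccontinuous_iff; intros eps He.
pose proof (Cmod_ge_0 (f t)); pose proof (Cmod_ge_0 (g t)).
set (e := Rmin 1 (eps / (Cmod (f t) + Cmod (g t) + 2))).
assert (He' : 0 < e).
{ apply Rmin_pos; [lra|]; apply Rdiv_lt_0_compat; lra. }
assert (He1 : e <= 1) by apply Rmin_l.
assert (He2 : e * (Cmod (f t) + Cmod (g t) + 2) <= eps).
{ apply Rle_trans with
    (eps / (Cmod (f t) + Cmod (g t) + 2) * (Cmod (f t) + Cmod (g t) + 2)).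
  - apply Rmult_le_compat_r; [lra|apply Rmin_r].
  - right; field; lra. }
destruct (Hf' e He') as [d1 [Hd1 H1]]; destruct (Hg' e He') as [d2 [Hd2 H2]].
exists (Rmin d1 d2); split; [apply Rmin_pos; assumption|]; intros s Hs.
specialize (H1 s ltac:(eapply Rlt_le_trans; [exact Hs|apply Rmin_l])).
specialize (H2 s ltac:(eapply Rlt_le_trans; [exact Hs|apply Rmin_r])).
replace (f s * g s - f t * g t)%C with
  ((f s - f t) * (g s - g t) + (f s - f t) * g t + f t * (g s - g t))%C by ring.
eapply Rle_lt_trans; [apply Cmod_triangle|].
eapply Rle_lt_trans; [apply Rplus_le_compat_r, Cmod_triangle|].
rewrite !Cmod_mult.
pose proof (Cmod_ge_0 (f s - f t)); pose proof (Cmod_ge_0 (g s - g t)).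
nra.
Qed.

Lemma ccontinuous_const (c : C) (t : R) : ccontinuous (fun _ => c) t.
Proof. apply continuous_const. Qed.

Lemma ccontinuous_comp (f : C -> C) (g : R -> C) (t : R) :
  ex_derive (K := C_AbsRing) (V := C_NormedModule) f (g t) ->
  ccontinuous g t -> ccontinuous (fun s => f (g s)) t.
Proof.
intros [l Hl] Hg; apply ccontinuous_iff; intros eps He.
destruct (is_cderive_continuous f (g t) l Hl eps He) as [d [Hd H]].
destruct (proj1 (ccontinuous_iff _ _) Hg d Hd) as [d' [Hd' H']].
exists d'; split; [exact Hd'|]; intros s Hs.
specialize (H _ (H' s Hs)).
now replace (g t + (g s - g t))%C with (g s) in H by ring.
Qed.

(** The absolute value makes the estimate independent of the order of the
    bounds, which is what the primitive built below requires. *)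
Lemma Cmod_CInt_le (f : R -> C) (a b M : R) (l : C) :
  (forall t, Rmin a b <= t <= Rmax a b -> Cmod (f t) <= M) ->
  is_CInt f a b l -> Cmod l <= M * Rabs (b - a).
Proof.
assert (G : forall a b l, a <= b ->
  (forall t, a <= t <= b -> Cmod (f t) <= M) ->
  is_CInt f a b l -> Cmod l <= M * Rabs (b - a)).
{ intros a' b' l' Hab H HI.
  rewrite Rabs_pos_eq by lra; rewrite Rmult_comm, Cmod_norm.
  apply norm_RInt_le_const with (2 := fun x Hx => eq_ind _ (fun r => r <= M) (H x Hx) _ (Cmod_norm (f x))) (3 := HI); exact Hab. }
intros H HI; destruct (Rle_dec a b) as [Hab|Hab].
- apply (G a b l Hab); [|exact HI].
  rewrite Rmin_left, Rmax_right in H by lra; exact H.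
- assert (Hba : b <= a) by lra.
  rewrite Rmin_right, Rmax_left in H by lra.
  apply is_RInt_swap in HI.
  specialize (G b a _ Hba H HI).
  rewrite Rabs_minus_sym.
  change (opp l) with (- l)%C in G; rewrite Cmod_opp in G; exact G.
Qed.

(** Newton-Leibniz along a path: the integral of f dz has the increment of a
    primitive of f as its value. *)
Lemma is_CInt_comp_derive (F f : C -> C) (g : R -> C) (v : R -> C) (a b : R) :
  (forall t, Rmin a b <= t <= Rmax a b -> is_cderive F (g t) (f (g t))) ->
  (forall t, Rmin a b <= t <= Rmax a b -> is_rderive g t (v t)) ->
  (forall t, Rmin a b <= t <= Rmax a b -> ccontinuous (fun s => f (g s)) t) ->
  (forall t, Rmin a b <= t <= Rmax a b -> ccontinuous v t) ->
  is_CInt (fun t => f (g t) * v t)%C a b (F (g b) - F (g a))%C.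
Proof.
intros HF Hg Hf Hv.
apply (is_RInt_derive (V := C_R_CompleteNormedModule)
  (fun t => F (g t)) (fun t => (f (g t) * v t)%C)).
- intros t Ht; apply is_rderive_comp; auto.
- intros t Ht; apply ccontinuous_mult; auto.
Qed.

(** The mean value theorem fails for complex values; its inequality is recovered
    by applying it to Re (conj v * F), where v = F w - F z, whose increment from z
    to w is |v|^2. *)
Lemma Cmod_mean_value (F : C -> C) (z w : C) (M : R) :
  (forall t, 0 <= t <= 1 -> exists l,
     is_cderive F (z + RtoC t * (w - z))%C l /\ Cmod l <= M) ->
  Cmod (F w - F z) <= M * Cmod (w - z).
Proof.
intros H.
set (v := (F w - F z)%C); set (g := fun t : R => (z + RtoC t * (w - z))%C).
destruct (Req_dec (Cmod v) 0) as [E|E].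
{ rewrite E; apply Rmult_le_pos; [|apply Cmod_ge_0].
  destruct (H 0) as [l [_ Hl]]; [lra|]; pose proof (Cmod_ge_0 l); lra. }
set (phi := fun t : R => Re (Cconj v * F (g t))).
assert (HR : forall t l, is_rderive (fun s => F (g s)) t l ->
          is_derive phi t (Re (Cconj v * l))).
{ intros t l Hl; apply is_derive_Reals; intros eps He.
  pose proof (Cmod_ge_0 v).
  destruct (proj1 (is_rderive_iff _ _ _) Hl (eps / 2 / Cmod v)) as [d [Hd HH]].
  { apply Rdiv_lt_0_compat; lra. }
  exists (mkposreal d Hd); intros h Hh0 Hh; specialize (HH h Hh).
  assert (Hhp : 0 < Rabs h) by now apply Rabs_pos_lt.
  replace ((phi (t + h) - phi t) / h - Re (Cconj v * l)) with
    (Re (Cconj v * (F (g (t + h)%R) - F (g t) - RtoC h * l)) / h).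
  2:{ unfold phi; unfold Re, Cconj, Cmult, Cminus, Cplus, Copp, RtoC; simpl.
      field; exact Hh0. }
  unfold Rdiv at 1; rewrite Rabs_mult, Rabs_inv.
  apply Rmult_lt_reg_r with (Rabs h); [exact Hhp|].
  rewrite Rmult_assoc, Rinv_l, Rmult_1_r by lra.
  eapply Rle_lt_trans; [apply re_le_Cmod|].
  rewrite Cmod_mult, Cmod_conj.
  apply Rle_lt_trans with (Cmod v * (eps / 2 / Cmod v * Rabs h)).
  - apply Rmult_le_compat_l; lra.
  - replace (Cmod v * (eps / 2 / Cmod v * Rabs h)) with (eps / 2 * Rabs h)
      by (field; lra); nra. }
assert (Hd : forall t, 0 <= t <= 1 ->
  is_derive phi t (Re (Cconj v * (C_derive F (g t) * (w - z)))) /\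
  Cmod (C_derive F (g t)) <= M).
{ intros t Ht; destruct (H t Ht) as [l [Hl Ml]].
  rewrite (is_C_derive_unique F (g t) l Hl); split; [|exact Ml].
  apply HR, is_rderive_comp; [exact Hl|apply is_rderive_affine]. }
destruct (MVT_gen phi 0 1
  (fun t => Re (Cconj v * (C_derive F (g t) * (w - z))))) as [t [Ht E1]].
{ rewrite Rmin_left, Rmax_right by lra; intros x Hx; apply Hd; lra. }
{ rewrite Rmin_left, Rmax_right by lra; intros x Hx.
  apply derivable_continuous_pt.
  eexists; apply is_derive_Reals, Hd; exact Hx. }
rewrite Rmin_left, Rmax_right in Ht by lra.
assert (E2 : phi 1 - phi 0 = Cmod v ^ 2).
{ rewrite Cmod2_alt; unfold phi, g.
  replace (z + RtoC 1 * (w - z))%C with w by ring.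
  replace (z + RtoC 0 * (w - z))%C with z by ring.
  unfold v, Re, Im, Cconj, Cmult, Cminus, Cplus, Copp; simpl; ring. }
rewrite E2 in E1.
apply Rmult_le_reg_l with (Cmod v).
{ pose proof (Cmod_ge_0 v); lra. }
replace (Cmod v * Cmod v) with (Cmod v ^ 2) by ring; rewrite E1.
eapply Rle_trans; [apply Rle_trans with (1 := Rle_abs _)|].
{ rewrite Rminus_0_r, Rmult_1_r; apply re_le_Cmod. }
rewrite !Cmod_mult, Cmod_conj.
apply Rmult_le_compat_l; [apply Cmod_ge_0|].
apply Rmult_le_compat_r; [apply Cmod_ge_0|].
apply Hd; exact Ht.
Qed.

(** * Goursat's theorem and primitives *)

Definition hor_int (f : C -> C) (y a b : R) : C := CInt (fun t => f (t, y)) a b.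
Definition ver_int (f : C -> C) (x a b : R) : C :=
  CInt (fun t => f (x, t) * Ci)%C a b.

(** The integral of f dz along the boundary, counterclockwise. *)
Definition rect_int (f : C -> C) (x1 x2 y1 y2 : R) : C :=
  (hor_int f y1 x1 x2 + ver_int f x2 y1 y2
   - hor_int f y2 x1 x2 - ver_int f x1 y1 y2)%C.

Notation cdiff := (ex_derive (K := C_AbsRing) (V := C_NormedModule)).

Lemma ccontinuous_hor (f : C -> C) (y t : R) :
  cdiff f (t, y) -> ccontinuous (fun s => f (s, y)) t.
Proof.
intros H; apply (ccontinuous_comp f (fun s => (s, y))); [exact H|].
apply (is_rderive_ccontinuous _ _ _ (is_rderive_hor y t)).
Qed.

Lemma ccontinuous_ver (f : C -> C) (x t : R) :
  cdiff f (x, t) -> ccontinuous (fun s => f (x, s)) t.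
Proof.
intros H; apply (ccontinuous_comp f (fun s => (x, s))); [exact H|].
apply (is_rderive_ccontinuous _ _ _ (is_rderive_ver x t)).
Qed.

Lemma is_CInt_hor (f : C -> C) (y a b : R) :
  (forall t, Rmin a b <= t <= Rmax a b -> cdiff f (t, y)) ->
  is_CInt (fun t => f (t, y)) a b (hor_int f y a b).
Proof.
intros H; apply (RInt_correct (V := C_R_CompleteNormedModule)).
apply (ex_RInt_continuous (V := C_R_CompleteNormedModule)).
intros t Ht; apply ccontinuous_hor, H, Ht.
Qed.

Lemma is_CInt_ver (f : C -> C) (x a b : R) :
  (forall t, Rmin a b <= t <= Rmax a b -> cdiff f (x, t)) ->
  is_CInt (fun t => f (x, t) * Ci)%C a b (ver_int f x a b).
Proof.
intros H; apply (RInt_correct (V := C_R_CompleteNormedModule)).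
apply (ex_RInt_continuous (V := C_R_CompleteNormedModule)).
intros t Ht; apply ccontinuous_mult; [|apply ccontinuous_const].
apply ccontinuous_ver, H, Ht.
Qed.

Lemma is_cderive_affine_primitive (c l z0 z : C) :
  is_cderive (fun w => c * w + l * (w - z0) * (w - z0) / 2)%C z
    (c + l * (z - z0))%C.
Proof.
apply is_cderive_iff; intros eps He.
pose proof (Cmod_ge_0 l).
exists (eps / (Cmod l + 1)); split; [apply Rdiv_lt_0_compat; lra|].
intros h Hh; pose proof (Cmod_ge_0 h).
match goal with |- Cmod ?e <= _ => replace e with (l * h * h / 2)%C end.
2:{ field; intros E; injection E; lra. }
unfold Cdiv; rewrite !Cmod_mult, Cmod_inv, Cmod_R, Rabs_pos_eq by
  (try lra; intros E; injection E; lra).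
apply Rmult_lt_compat_r with (r := Cmod l + 1) in Hh; [|lra].
replace (eps / (Cmod l + 1) * (Cmod l + 1)) with eps in Hh by (field; lra).
apply Rle_trans with ((Cmod h * (Cmod l + 1)) * Cmod h); nra.
Qed.

Lemma is_CInt_minus (f g : R -> C) (a b : R) (u v : C) :
  is_CInt f a b u -> is_CInt g a b v ->
  is_CInt (fun t => f t - g t)%C a b (u - v)%C.
Proof. apply (is_RInt_minus (V := C_R_NormedModule)). Qed.

(** The first-order expansion of f at z0 has a primitive, a polynomial of degree
    2, so it contributes nothing to the boundary integral.  Only the remainder
    counts: it is at most eps times the diameter, on a boundary of length
    comparable to the diameter. *)
Lemma rect_int_small (f : C -> C) (z0 l : C) (eps : R) :
  is_cderive f z0 l -> 0 < eps ->
  exists delta, 0 < delta /\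
    forall x1 x2 y1 y2,
      x1 <= fst z0 <= x2 -> y1 <= snd z0 <= y2 ->
      (x2 - x1) + (y2 - y1) < delta ->
      (forall x y, x1 <= x <= x2 -> y1 <= y <= y2 -> cdiff f (x, y)) ->
      Cmod (rect_int f x1 x2 y1 y2) <= 2 * eps * ((x2 - x1) + (y2 - y1)) ^ 2.
Proof.
intros Hl He.
destruct (proj1 (is_cderive_iff _ _ _) Hl eps He) as [d [Hd H]].
exists d; split; [exact Hd|]; intros x1 x2 y1 y2 Hx Hy Hdiam Hdiff.
set (L := x2 - x1 + (y2 - y1)) in *.
set (A := fun w : C => (f z0 + l * (w - z0))%C).
set (B := fun w : C => (f z0 * w + l * (w - z0) * (w - z0) / 2)%C).
assert (HB : forall w, is_cderive B w (A w))
  by (intros w; apply is_cderive_affine_primitive).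
assert (HA : forall w, cdiff A w).
{ intros w; exists l; apply is_cderive_iff; intros e Hpe.
  exists 1; split; [lra|]; intros h _; unfold A.
  match goal with |- Cmod ?e <= _ => replace e with (RtoC 0) by ring end.
  rewrite Cmod_0; apply Rmult_le_pos; [lra|apply Cmod_ge_0]. }
assert (Hclose : forall x y, x1 <= x <= x2 -> y1 <= y <= y2 ->
          Cmod (f (x, y) - A (x, y)) <= eps * L).
{ intros x y Hx' Hy'.
  set (h := ((x, y) - z0)%C).
  assert (Hh : Cmod h <= L).
  { apply Rle_trans with (1 := Cmod_pair (x - fst z0) (y - snd z0)).
    unfold L, Rabs; repeat destruct Rcase_abs; lra. }
  specialize (H h ltac:(lra)).
  replace (z0 + h)%C with ((x, y) : C) in H
    by (unfold h; apply injective_projections; simpl; ring).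
  unfold A; fold h.
  replace (f (x, y) - (f z0 + l * h))%C with (f (x, y) - f z0 - l * h)%C by ring.
  apply Rle_trans with (1 := H); nra. }
assert (Hhor : forall y, y1 <= y <= y2 ->
  Cmod (hor_int f y x1 x2 - (B (x2, y) - B (x1, y))) <= eps * L * (x2 - x1)).
{ intros y Hy'.
  rewrite <- (Rabs_pos_eq (x2 - x1)) at 1 by lra.
  apply Cmod_CInt_le with (f := fun t => (f (t, y) - A (t, y))%C).
  - rewrite Rmin_left, Rmax_right by lra; intros t Ht; apply Hclose; assumption.
  - apply is_CInt_minus.
    + apply is_CInt_hor; rewrite Rmin_left, Rmax_right by lra; auto.
    + apply (is_RInt_ext (V := C_R_NormedModule)
              (fun t => A (t, y) * RtoC 1)%C); [intros t _; apply Cmult_1_r|].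
      apply (is_CInt_comp_derive B A (fun t => (t, y)) (fun _ => RtoC 1)).
      * intros; apply HB.
      * intros; apply is_rderive_hor.
      * intros; apply ccontinuous_hor, HA.
      * intros; apply ccontinuous_const. }
assert (Hver : forall x, x1 <= x <= x2 ->
  Cmod (ver_int f x y1 y2 - (B (x, y2) - B (x, y1))) <= eps * L * (y2 - y1)).
{ intros x Hx'.
  rewrite <- (Rabs_pos_eq (y2 - y1)) at 1 by lra.
  apply Cmod_CInt_le with (f := fun t => (f (x, t) * Ci - A (x, t) * Ci)%C).
  - rewrite Rmin_left, Rmax_right by lra; intros t Ht.
    replace (f (x, t) * Ci - A (x, t) * Ci)%C
      with ((f (x, t) - A (x, t)) * Ci)%C by ring.
    rewrite Cmod_mult, Cmod_Ci, Rmult_1_r; apply Hclose; assumption.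
  - apply is_CInt_minus.
    + apply is_CInt_ver; rewrite Rmin_left, Rmax_right by lra; auto.
    + apply (is_CInt_comp_derive B A (fun t => (x, t)) (fun _ => Ci)).
      * intros; apply HB.
      * intros; apply is_rderive_ver.
      * intros; apply ccontinuous_ver, HA.
      * intros; apply ccontinuous_const. }
unfold rect_int.
pose proof (Hhor y1 ltac:(lra)) as B1; pose proof (Hhor y2 ltac:(lra)) as B2.
pose proof (Hver x1 ltac:(lra)) as B3; pose proof (Hver x2 ltac:(lra)) as B4.
replace (hor_int f y1 x1 x2 + ver_int f x2 y1 y2
   - hor_int f y2 x1 x2 - ver_int f x1 y1 y2)%C with
 ((hor_int f y1 x1 x2 - (B (x2, y1) - B (x1, y1)))
  + ((ver_int f x2 y1 y2 - (B (x2, y2) - B (x2, y1)))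
  + (- (hor_int f y2 x1 x2 - (B (x2, y2) - B (x1, y2)))
  + - (ver_int f x1 y1 y2 - (B (x1, y2) - B (x1, y1))))))%C by ring.
eapply Rle_trans; [apply Cmod_triangle|].
eapply Rle_trans; [apply Rplus_le_compat_l, Cmod_triangle|].
eapply Rle_trans; [apply Rplus_le_compat_l, Rplus_le_compat_l, Cmod_triangle|].
rewrite !Cmod_opp.
replace (2 * eps * L ^ 2) with
  (eps * L * (x2 - x1) + eps * L * (y2 - y1)
   + (eps * L * (x2 - x1) + eps * L * (y2 - y1))) by (unfold L; ring).
lra.
Qed.

Lemma hor_int_Chasles (f : C -> C) (y a b c : R) :
  (forall t, Rmin a b <= t <= Rmax a b -> cdiff f (t, y)) ->
  (forall t, Rmin b c <= t <= Rmax b c -> cdiff f (t, y)) ->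
  hor_int f y a c = (hor_int f y a b + hor_int f y b c)%C.
Proof.
intros H1 H2; symmetry.
apply (RInt_Chasles (V := C_R_CompleteNormedModule)); eexists;
  apply is_CInt_hor; assumption.
Qed.

Lemma ver_int_Chasles (f : C -> C) (x a b c : R) :
  (forall t, Rmin a b <= t <= Rmax a b -> cdiff f (x, t)) ->
  (forall t, Rmin b c <= t <= Rmax b c -> cdiff f (x, t)) ->
  ver_int f x a c = (ver_int f x a b + ver_int f x b c)%C.
Proof.
intros H1 H2; symmetry.
apply (RInt_Chasles (V := C_R_CompleteNormedModule)); eexists;
  apply is_CInt_ver; assumption.
Qed.

Lemma rect_int_split (f : C -> C) (x1 x x2 y1 y y2 : R) :
  x1 <= x <= x2 -> y1 <= y <= y2 ->
  (forall s t, x1 <= s <= x2 -> y1 <= t <= y2 -> cdiff f (s, t)) ->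
  rect_int f x1 x2 y1 y2 =
   (rect_int f x1 x y1 y + rect_int f x x2 y1 y
    + rect_int f x1 x y y2 + rect_int f x x2 y y2)%C.
Proof.
intros Hx Hy H; unfold rect_int.
rewrite (hor_int_Chasles f y1 x1 x x2), (hor_int_Chasles f y2 x1 x x2),
  (ver_int_Chasles f x1 y1 y y2), (ver_int_Chasles f x2 y1 y y2);
  try ring; rewrite Rmin_left, Rmax_right by lra; intros; apply H; lra.
Qed.

(** Halving both sides keeps the shape of the rectangle; one of the four pieces
    carries at least a quarter of the integral. *)
Lemma rect_int_bisect (f : C -> C) (x y p q : R) :
  0 <= p -> 0 <= q ->
  (forall s t, x <= s <= x + p -> y <= t <= y + q -> cdiff f (s, t)) ->
  exists x' y', (x' = x \/ x' = x + p / 2) /\ (y' = y \/ y' = y + q / 2) /\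
    Cmod (rect_int f x (x + p) y (y + q)) <=
      4 * Cmod (rect_int f x' (x' + p / 2) y' (y' + q / 2)).
Proof.
intros Hp Hq H.
rewrite (rect_int_split f x (x + p / 2) (x + p) y (y + q / 2) (y + q))
  by (assumption || lra).
replace (x + p) with (x + p / 2 + p / 2) by field.
replace (y + q) with (y + q / 2 + q / 2) by field.
set (J := fun x y => rect_int f x (x + p / 2) y (y + q / 2)).
change (exists x' y', (x' = x \/ x' = x + p / 2) /\ (y' = y \/ y' = y + q / 2) /\
  Cmod (J x y + J (x + p / 2)%R y + J x (y + q / 2)%R
        + J (x + p / 2)%R (y + q / 2)%R) <= 4 * Cmod (J x' y')).
match goal with |- exists x' y', _ /\ _ /\ Cmod ?e <= _ => set (S := Cmod e) end.
assert (HS : S <= Cmod (J x y) + Cmod (J (x + p / 2) y)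
              + Cmod (J x (y + q / 2)) + Cmod (J (x + p / 2) (y + q / 2))).
{ unfold S; eapply Rle_trans; [apply Cmod_triangle|].
  apply Rplus_le_compat_r.
  eapply Rle_trans; [apply Cmod_triangle|].
  apply Rplus_le_compat_r, Cmod_triangle. }
destruct (Rle_dec S (4 * Cmod (J x y))) as [?|N1];
  [exists x, y; auto|].
destruct (Rle_dec S (4 * Cmod (J (x + p / 2) y))) as [?|N2];
  [exists (x + p / 2), y; auto|].
destruct (Rle_dec S (4 * Cmod (J x (y + q / 2)))) as [?|N3];
  [exists x, (y + q / 2); auto|].
exists (x + p / 2), (y + q / 2); split; [auto|]; split; [auto|]; lra.
Qed.

Lemma nested_intervals (u v : nat -> R) :
  (forall n, u n <= u (S n)) -> (forall n, v (S n) <= v n) ->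
  (forall n, u n <= v n) -> exists l, forall n, u n <= l <= v n.
Proof.
intros Hu Hv Huv.
assert (Mu : forall n m, (n <= m)%nat -> u n <= u m).
{ induction 1; [lra|]; eapply Rle_trans; [eassumption|apply Hu]. }
assert (Mv : forall n m, (n <= m)%nat -> v m <= v n).
{ induction 1; [lra|]; eapply Rle_trans; [apply Hv|eassumption]. }
assert (Hb : forall n m, u n <= v m).
{ intros n m; apply Rle_trans with (u (max n m)); [apply Mu; lia|].
  apply Rle_trans with (v (max n m)); [apply Huv|apply Mv; lia]. }
destruct (completeness (fun x => exists n, x = u n)) as [l [H1 H2]].
- exists (v O); intros x [n ->]; apply Hb.
- exists (u O); exists O; reflexivity.
- exists l; intros n; split.
  + apply H1; exists n; reflexivity.
  + apply H2; intros x [m ->]; apply Hb.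
Qed.

(** Iterating the bisection, the n-th rectangle has an integral of modulus at
    least 4^(-n) times the initial one, and shrinks to a point where f is
    differentiable.  There [rect_int_small] bounds the same integral by
    eps 4^(-n) times a constant, for every eps. *)
Theorem goursat (f : C -> C) (x1 x2 y1 y2 : R) :
  x1 <= x2 -> y1 <= y2 ->
  (forall x y, x1 <= x <= x2 -> y1 <= y <= y2 -> cdiff f (x, y)) ->
  rect_int f x1 x2 y1 y2 = RtoC 0.
Proof.
intros Hx Hy Hdiff.
set (p := x2 - x1); set (q := y2 - y1).
assert (Hp : 0 <= p) by (unfold p; lra).
assert (Hq : 0 <= q) by (unfold q; lra).
set (inside := fun (n : nat) (c : R * R) =>
  x1 <= fst c /\ fst c + p / 2 ^ n <= x2 /\
  y1 <= snd c /\ snd c + q / 2 ^ n <= y2).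
set (J := fun (n : nat) (c : R * R) =>
  Cmod (rect_int f (fst c) (fst c + p / 2 ^ n) (snd c) (snd c + q / 2 ^ n))).
assert (Hpow : forall n, 0 < 2 ^ n) by (intros; apply pow_lt; lra).
assert (Hpn : forall n, 0 <= p / 2 ^ n)
  by (intros; apply Rdiv_le_0_compat; auto).
assert (Hqn : forall n, 0 <= q / 2 ^ n)
  by (intros; apply Rdiv_le_0_compat; auto).
assert (Hhalf : forall (r : R) n, r / 2 ^ n / 2 = r / 2 ^ S n).
{ intros r n; simpl; field; specialize (Hpow n); lra. }
assert (step : forall n c, exists c' : R * R, inside n c ->
  (fst c <= fst c' /\ fst c' + p / 2 ^ S n <= fst c + p / 2 ^ n) /\
  (snd c <= snd c' /\ snd c' + q / 2 ^ S n <= snd c + q / 2 ^ n) /\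
  J n c <= 4 * J (S n) c').
{ intros n [x y].
  destruct (excluded_middle_informative (inside n (x, y))) as [I|I];
    [|exists (x, y); contradiction].
  unfold inside in I; simpl in I.
  destruct (rect_int_bisect f x y (p / 2 ^ n) (q / 2 ^ n)) as [x' [y' [Ex [Ey E]]]];
    auto.
  { intros s t Hs Ht; apply Hdiff; lra. }
  exists (x', y'); intros _; unfold J; cbn [fst snd].
  specialize (Hpn n); specialize (Hqn n).
  rewrite <- !Hhalf; split; [destruct Ex; lra|]; split; [destruct Ey; lra|].
  exact E. }
set (next := fun n c => proj1_sig (constructive_indefinite_description _ (step n c))).
assert (Hnext : forall n c, inside n c ->
  (fst c <= fst (next n c) /\ fst (next n c) + p / 2 ^ S n <= fst c + p / 2 ^ n) /\
  (snd c <= snd (next n c) /\ snd (next n c) + q / 2 ^ S n <= snd c + q / 2 ^ n) /\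
  J n c <= 4 * J (S n) (next n c)).
{ intros n c; exact (proj2_sig (constructive_indefinite_description _ (step n c))). }
clearbody next.
set (c := fix c n := match n with O => (x1, y1) | S m => next m (c m) end).
assert (Hin : forall n, inside n (c n)).
{ induction n as [|n IH].
  - unfold inside; simpl; unfold p, q; lra.
  - destruct (Hnext n (c n) IH) as [[A1 A2] [[A3 A4] _]].
    unfold inside in *; change (c (S n)) with (next n (c n)); lra. }
assert (HJ : forall n, J O (c O) <= 4 ^ n * J n (c n)).
{ induction n as [|n IH]; [simpl; lra|].
  destruct (Hnext n (c n) (Hin n)) as [_ [_ A]].
  change (c (S n)) with (next n (c n)).
  apply Rle_trans with (1 := IH).
  change (4 ^ S n) with (4 * 4 ^ n).
  pose proof (pow_lt 4 n ltac:(lra)); nra. }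
destruct (nested_intervals (fun n => fst (c n)) (fun n => fst (c n) + p / 2 ^ n))
  as [xl Hxl].
{ intros n; apply (Hnext n (c n) (Hin n)). }
{ intros n; apply (Hnext n (c n) (Hin n)). }
{ intros n; specialize (Hpn n); lra. }
destruct (nested_intervals (fun n => snd (c n)) (fun n => snd (c n) + q / 2 ^ n))
  as [yl Hyl].
{ intros n; apply (Hnext n (c n) (Hin n)). }
{ intros n; apply (Hnext n (c n) (Hin n)). }
{ intros n; specialize (Hqn n); lra. }
assert (E0 : J O (c O) = Cmod (rect_int f x1 x2 y1 y2)).
{ unfold J, c; cbn [fst snd]; unfold p, q.
  replace (x1 + (x2 - x1) / 2 ^ 0) with x2 by (simpl; field).
  replace (y1 + (y2 - y1) / 2 ^ 0) with y2 by (simpl; field).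
  reflexivity. }
rewrite E0 in HJ.
apply Cmod_eq_0, Rle_antisym; [|apply Cmod_ge_0].
apply Rnot_lt_le; intros Hpos; set (m := Cmod (rect_int f x1 x2 y1 y2)) in *.
destruct (Hdiff xl yl) as [l Hl].
{ destruct (Hin O) as [A1 [A2 _]]; specialize (Hxl O); simpl in *; lra. }
{ destruct (Hin O) as [_ [_ [A1 A2]]]; specialize (Hyl O); simpl in *; lra. }
assert (Hpq : 0 < 4 * ((p + q) ^ 2 + 1)) by nra.
(* With this eps the bound of [rect_int_small] is less than m / 4^n. *)
destruct (rect_int_small f (xl, yl) l (m / (4 * ((p + q) ^ 2 + 1))) Hl)
  as [d [Hd H]]; [apply Rdiv_lt_0_compat; lra|].
destruct (pow_lt_1_zero (/ 2) ltac:(rewrite Rabs_pos_eq; lra)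
            (d / (p + q + 1)) ltac:(apply Rdiv_lt_0_compat; lra)) as [n Hn].
specialize (Hn n (le_n n)).
rewrite Rabs_pos_eq in Hn by (apply pow_le; lra).
rewrite pow_inv in Hn.
assert (Hsmall : (p + q) / 2 ^ n < d).
{ apply Rmult_lt_compat_r with (r := p + q + 1) in Hn; [|lra].
  replace (d / (p + q + 1) * (p + q + 1)) with d in Hn by (field; lra).
  apply Rle_lt_trans with (2 := Hn).
  unfold Rdiv; rewrite (Rmult_comm _ (p + q + 1)).
  apply Rmult_le_compat_r; [|lra].
  left; apply Rinv_0_lt_compat; auto. }
specialize (HJ n); unfold J in HJ.
destruct (Hin n) as [A1 [A2 [A3 A4]]].
set (X := fst (c n)) in *; set (Y := snd (c n)) in *.
specialize (H X (X + p / 2 ^ n) Y (Y + q / 2 ^ n)).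
assert (HH := H (Hxl n) (Hyl n)); clear H.
replace (X + p / 2 ^ n - X + (Y + q / 2 ^ n - Y)) with ((p + q) / 2 ^ n) in HH
  by (field; specialize (Hpow n); lra).
specialize (HH Hsmall).
assert (HD : forall x y, X <= x <= X + p / 2 ^ n -> Y <= y <= Y + q / 2 ^ n ->
   cdiff f (x, y)) by (intros; apply Hdiff; lra).
specialize (HH HD).
apply Rmult_le_compat_l with (r := 4 ^ n) in HH; [|apply pow_le; lra].
assert (E4 : 4 ^ n = 2 ^ n * 2 ^ n).
{ rewrite <- Rpow_mult_distr; f_equal; lra. }
replace (4 ^ n * (2 * (m / (4 * ((p + q) ^ 2 + 1))) * ((p + q) / 2 ^ n) ^ 2))
  with (m * ((p + q) ^ 2 / (2 * ((p + q) ^ 2 + 1)))) in HH.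
2:{ rewrite E4; field; split; [specialize (Hpow n); lra|nra]. }
assert ((p + q) ^ 2 / (2 * ((p + q) ^ 2 + 1)) < 1).
{ apply Rmult_lt_reg_r with (2 * ((p + q) ^ 2 + 1)); [nra|].
  unfold Rdiv; rewrite Rmult_assoc, Rinv_l by nra; nra. }
nra.
Qed.

Lemma hor_int_swap (f : C -> C) (y a b : R) :
  (forall t, Rmin a b <= t <= Rmax a b -> cdiff f (t, y)) ->
  hor_int f y b a = (- hor_int f y a b)%C.
Proof.
intros H; symmetry; apply (opp_RInt_swap (V := C_R_CompleteNormedModule)).
eexists; apply is_CInt_hor, H.
Qed.

Lemma ver_int_swap (f : C -> C) (x a b : R) :
  (forall t, Rmin a b <= t <= Rmax a b -> cdiff f (x, t)) ->
  ver_int f x b a = (- ver_int f x a b)%C.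
Proof.
intros H; symmetry; apply (opp_RInt_swap (V := C_R_CompleteNormedModule)).
eexists; apply is_CInt_ver, H.
Qed.

Lemma goursat_unordered (f : C -> C) (x1 x2 y1 y2 : R) :
  (forall x y, Rmin x1 x2 <= x <= Rmax x1 x2 ->
     Rmin y1 y2 <= y <= Rmax y1 y2 -> cdiff f (x, y)) ->
  rect_int f x1 x2 y1 y2 = RtoC 0.
Proof.
assert (P : forall x1 x2 y1 y2, x1 <= x2 ->
  (forall x y, x1 <= x <= x2 ->
     Rmin y1 y2 <= y <= Rmax y1 y2 -> cdiff f (x, y)) ->
  rect_int f x1 x2 y1 y2 = RtoC 0).
{ clear; intros x1 x2 y1 y2 Hx H; destruct (Rle_dec y1 y2) as [Hy|Hy].
  - rewrite Rmin_left, Rmax_right in H by lra; now apply goursat.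
  - rewrite Rmin_right, Rmax_left in H by lra.
    assert (G : rect_int f x1 x2 y2 y1 = RtoC 0) by (apply goursat; auto; lra).
    unfold rect_int in *.
    rewrite (ver_int_swap f x2 y2 y1), (ver_int_swap f x1 y2 y1).
    + transitivity (- RtoC 0)%C; [rewrite <- G|]; ring.
    + rewrite Rmin_left, Rmax_right by lra; intros; apply H; lra.
    + rewrite Rmin_left, Rmax_right by lra; intros; apply H; lra. }
intros H; destruct (Rle_dec x1 x2) as [Hx|Hx].
- rewrite Rmin_left, Rmax_right in H by lra; now apply P.
- rewrite (Rmin_right x1), (Rmax_left x1) in H by lra.
  assert (G : rect_int f x2 x1 y1 y2 = RtoC 0) by (apply P; auto; lra).
  unfold rect_int in *.
  rewrite (hor_int_swap f y1 x2 x1), (hor_int_swap f y2 x2 x1).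
  + transitivity (- RtoC 0)%C; [rewrite <- G|]; ring.
  + rewrite Rmin_left, Rmax_right by lra; intros; apply H; try lra.
    split; [apply Rmin_r|apply Rmax_r].
  + rewrite Rmin_left, Rmax_right by lra; intros; apply H; try lra.
    split; [apply Rmin_l|apply Rmax_l].
Qed.

Lemma is_CInt_const (a b : R) (v : C) :
  is_CInt (fun _ => v) a b (RtoC (b - a) * v)%C.
Proof. rewrite <- scal_R_Cmult; apply (is_RInt_const (V := C_R_NormedModule)). Qed.

(** The primitive is the integral of f along the path 0, x, x + i y.  Goursat's
    theorem on the rectangle with horizontal side [x, x + h1] and vertical side
    [0, y] moves the increment of this integral to a path that starts at x + i y
    and stays close to it.  The two conditions on the shape of U ensure that the
    paths and the rectangles used are contained in U. *)
Theorem exists_primitive (U : C -> Prop) (f : C -> C) :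
  (forall z, U z -> exists delta, 0 < delta /\
     forall h, Cmod h < delta -> U (z + h)%C) ->
  (forall x y y', U (x, y) -> Rabs y' <= Rabs y -> U (x, y')) ->
  (forall x x' y, U (x, y) -> Rmin 0 x <= x' <= Rmax 0 x -> U (x', 0)) ->
  (forall z, U z -> cdiff f z) ->
  exists F : C -> C, forall z, U z -> is_cderive F z (f z).
Proof.
intros Uopen Uver Uhor Hf.
exists (fun z => hor_int f 0 0 (fst z) + ver_int f (fst z) 0 (snd z))%C.
intros [x y] Uz; apply is_cderive_iff; intros eps He.
destruct (Uopen _ Uz) as [d0 [Hd0 HU]].
destruct (Hf _ Uz) as [l Hl].
destruct (is_cderive_continuous f _ l Hl (eps / 2) ltac:(lra)) as [d1 [Hd1 Hc]].
assert (Hm : 0 < Rmin d0 d1) by (apply Rmin_pos; assumption).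
exists (Rmin d0 d1 / 2); split; [lra|].
intros [h1 h2] Hh; cbn [fst snd Cplus].
assert (Hh1 : Rabs h1 <= Cmod (h1, h2)) by apply (re_le_Cmod (h1, h2)).
assert (Hh2 : Rabs h2 <= Cmod (h1, h2)) by apply (im_le_Cmod (h1, h2)).
assert (Hnear : forall s t, Rmin x (x + h1) <= s <= Rmax x (x + h1) ->
   Rmin y (y + h2) <= t <= Rmax y (y + h2) -> exists k : C,
   (s, t) = ((x, y) + k)%C /\ Cmod k < Rmin d0 d1).
{ intros s t Hs Ht; exists (s - x, t - y); split.
  { apply injective_projections; simpl; ring. }
  apply Rle_lt_trans with (1 := Cmod_pair _ _).
  assert (Rabs (s - x) <= Rabs h1)
    by (revert Hs; unfold Rmin, Rmax, Rabs; repeat destruct Rcase_abs;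
        repeat destruct Rle_dec; lra).
  assert (Rabs (t - y) <= Rabs h2)
    by (revert Ht; unfold Rmin, Rmax, Rabs; repeat destruct Rcase_abs;
        repeat destruct Rle_dec; lra).
  lra. }
assert (Uq : forall s t, Rmin x (x + h1) <= s <= Rmax x (x + h1) ->
   Rmin y (y + h2) <= t <= Rmax y (y + h2) -> U (s, t)).
{ intros s t Hs Ht; destruct (Hnear s t Hs Ht) as [k [-> Hk]].
  apply HU; eapply Rlt_le_trans; [exact Hk|apply Rmin_l]. }
assert (Cq : forall s t, Rmin x (x + h1) <= s <= Rmax x (x + h1) ->
   Rmin y (y + h2) <= t <= Rmax y (y + h2) ->
   Cmod (f (s, t) - f (x, y)) <= eps / 2).
{ intros s t Hs Ht; destruct (Hnear s t Hs Ht) as [k [-> Hk]].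
  left; apply Hc; eapply Rlt_le_trans; [exact Hk|apply Rmin_r]. }
assert (Ly : Rmin y (y + h2) <= y <= Rmax y (y + h2))
  by (split; [apply Rmin_l|apply Rmax_l]).
assert (Lx : Rmin x (x + h1) <= x <= Rmax x (x + h1))
  by (split; [apply Rmin_l|apply Rmax_l]).
assert (Lx' : Rmin x (x + h1) <= x + h1 <= Rmax x (x + h1))
  by (split; [apply Rmin_r|apply Rmax_r]).
assert (Rabs0 : forall u v, Rmin 0 u <= v <= Rmax 0 u -> Rabs v <= Rabs u).
{ intros u v; unfold Rmin, Rmax, Rabs; repeat destruct Rcase_abs;
    repeat destruct Rle_dec; lra. }
rewrite (hor_int_Chasles f 0 0 x (x + h1)).
2:{ intros t Ht; apply Hf, (Uhor x t y); assumption. }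
2:{ intros t Ht; apply Hf, (Uver t y 0); [auto|].
    rewrite Rabs_R0; apply Rabs_pos. }
rewrite (ver_int_Chasles f (x + h1) 0 y (y + h2)).
2:{ intros t Ht; apply Hf, (Uver _ y); [auto|apply Rabs0, Ht]. }
2:{ intros t Ht; apply Hf; auto. }
assert (G := goursat_unordered f x (x + h1) 0 y); unfold rect_int in G.
assert (G' := G ltac:(intros s t Hs Ht; apply Hf, (Uver _ y);
                      [auto|apply Rabs0, Ht])); clear G.
set (H0 := hor_int f 0 0 x) in *; set (H1 := hor_int f 0 x (x + h1)) in *.
set (V0 := ver_int f x 0 y) in *; set (V1 := ver_int f (x + h1) 0 y) in *.
set (V2 := ver_int f (x + h1) y (y + h2)).
set (H2 := hor_int f y x (x + h1)) in *.
match goal with |- Cmod ?e <= _ => replace e with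
  ((H1 + V1 - H2 - V0) + ((H2 - RtoC (x + h1 - x) * f (x, y))
    + (V2 - RtoC (y + h2 - y) * (f (x, y) * Ci))))%C end.
2:{ replace (x + h1 - x) with h1 by ring; replace (y + h2 - y) with h2 by ring.
    replace ((h1, h2) : C) with (RtoC h1 + RtoC h2 * Ci)%C; [ring|].
    unfold RtoC, Ci; apply injective_projections; simpl; ring. }
rewrite G', Cplus_0_l.
apply Rle_trans with (1 := Cmod_triangle _ _).
assert (B1 : Cmod (H2 - RtoC (x + h1 - x) * f (x, y)) <= eps / 2 * Rabs (x + h1 - x)).
{ apply Cmod_CInt_le with (f := fun t => (f (t, y) - f (x, y))%C).
  - intros t Ht; apply Cq; assumption.
  - apply is_CInt_minus; [|apply is_CInt_const].
    apply is_CInt_hor; intros; apply Hf; auto. }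
assert (B2 : Cmod (V2 - RtoC (y + h2 - y) * (f (x, y) * Ci))
              <= eps / 2 * Rabs (y + h2 - y)).
{ apply Cmod_CInt_le with (f := fun t => (f (x + h1, t)%R * Ci - f (x, y) * Ci)%C).
  - intros t Ht.
    match goal with |- Cmod ?e <= _ =>
      replace e with ((f ((x + h1)%R, t) - f (x, y)) * Ci)%C by ring end.
    rewrite Cmod_mult, Cmod_Ci, Rmult_1_r; apply Cq; assumption.
  - apply is_CInt_minus; [|apply is_CInt_const].
    apply is_CInt_ver; intros; apply Hf; auto. }
replace (x + h1 - x) with h1 in B1 |- * by ring.
replace (y + h2 - y) with h2 in B2 |- * by ring.
nra.
Qed.

(** * Cauchy's formula for the derivative *)

Definition cexp (z : C) : C :=
  (exp (fst z) * cos (snd z), exp (fst z) * sin (snd z)).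

Lemma cexp_plus (z w : C) : cexp (z + w) = (cexp z * cexp w)%C.
Proof.
unfold cexp, Cmult; simpl; rewrite exp_plus, cos_plus, sin_plus.
apply injective_projections; simpl; ring.
Qed.

Lemma cexp_opp (z : C) : (cexp z * cexp (- z))%C = RtoC 1.
Proof.
rewrite <- cexp_plus; unfold cexp, RtoC; simpl.
rewrite !Rplus_opp_r, exp_0, cos_0, sin_0; f_equal; ring.
Qed.

Lemma Cmod_cexp (z : C) : Cmod (cexp z) = exp (fst z).
Proof.
unfold Cmod, cexp; simpl.
replace (_ + _) with (exp (fst z) ^ 2).
- apply sqrt_pow2; left; apply exp_pos.
- generalize (sin2_cos2 (snd z)); unfold Rsqr; intros E.
  transitivity (exp (fst z) ^ 2 *
    (sin (snd z) * sin (snd z) + cos (snd z) * cos (snd z)));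
    [rewrite E|]; ring.
Qed.

Lemma cexp_2PI (x : R) : cexp (x, 2 * PI) = cexp (x, 0).
Proof. unfold cexp; simpl; now rewrite cos_2PI, sin_2PI, cos_0, sin_0. Qed.

Lemma cexp_opp_2PI (x : R) : cexp (- (x, (2 * PI)%R))%C = cexp (- (x, 0%R))%C.
Proof.
unfold cexp; simpl.
now rewrite !cos_neg, !sin_neg, cos_2PI, sin_2PI, cos_0, sin_0.
Qed.

Lemma is_cderive_cexp_0 : is_cderive cexp (RtoC 0) (RtoC 1).
Proof.
assert (D : forall f l eps, derivable_pt_lim f 0 l -> 0 < eps -> exists d,
  0 < d /\ forall h, Rabs h < d -> Rabs (f h - f 0 - l * h) <= eps * Rabs h).
{ intros f l eps H He; destruct (H eps He) as [d Hd].
  exists d; split; [apply cond_pos|]; intros h Hh.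
  destruct (Req_dec h 0) as [->|Hh0].
  { rewrite Rmult_0_r, !Rminus_diag, Rabs_R0; lra. }
  specialize (Hd h Hh0 Hh); rewrite Rplus_0_l in Hd.
  replace (f h - f 0 - l * h) with (((f h - f 0) / h - l) * h) by (field; auto).
  rewrite Rabs_mult; apply Rmult_le_compat_r; [apply Rabs_pos|lra]. }
apply is_cderive_iff; intros eps He.
set (e := Rmin 1 (eps / 6)).
assert (Pe : 0 < e) by (apply Rmin_pos; lra).
assert (e <= 1) by apply Rmin_l.
assert (He6 : e <= eps / 6) by apply Rmin_r.
clearbody e.
destruct (D exp _ e (derivable_pt_lim_exp 0) Pe) as [d1 [Hd1 H1]].
destruct (D sin _ e (derivable_pt_lim_sin 0) Pe) as [d2 [Hd2 H2]].
destruct (D cos _ e (derivable_pt_lim_cos 0) Pe) as [d3 [Hd3 H3]].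
rewrite exp_0 in H1; rewrite sin_0, cos_0 in H2; rewrite sin_0, cos_0 in H3.
exists (Rmin (Rmin d1 e) (Rmin d2 d3)); split.
{ repeat apply Rmin_pos; assumption. }
intros [u v] Hh.
assert (Hu : Rabs u <= Cmod (u, v)) by apply (re_le_Cmod (u, v)).
assert (Hv : Rabs v <= Cmod (u, v)) by apply (im_le_Cmod (u, v)).
pose proof (Rmin_l (Rmin d1 e) (Rmin d2 d3)).
pose proof (Rmin_r (Rmin d1 e) (Rmin d2 d3)).
pose proof (Rmin_l d1 e); pose proof (Rmin_r d1 e).
pose proof (Rmin_l d2 d3); pose proof (Rmin_r d2 d3).
specialize (H1 u ltac:(lra)); specialize (H2 v ltac:(lra)).
specialize (H3 v ltac:(lra)).
set (N := Cmod (u, v)) in *.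
set (dc := cos v - 1 - -0 * v) in *; set (ds := sin v - 0 - 1 * v) in *.
set (de := exp u - 1 - 1 * u) in *.
replace (cexp (RtoC 0 + (u, v)) - cexp (RtoC 0) - RtoC 1 * (u, v))%C with
  (RtoC de * (cos v, sin v) +
   (RtoC (1 + u) * (dc, ds) + RtoC u * (0%R, v)))%C.
2:{ unfold de, dc, ds, cexp, RtoC; apply injective_projections; simpl;
    rewrite ?Rplus_0_l, ?exp_0, ?cos_0, ?sin_0; ring. }
assert (T1 : Cmod (cos v, sin v) = 1).
{ pose proof (Cmod_cexp (0, v)) as E; unfold cexp in E; simpl in E.
  rewrite exp_0, !Rmult_1_l in E; exact E. }
assert (T2 : Cmod (dc, ds) <= 2 * e * Rabs v).
{ apply Rle_trans with (1 := Cmod_pair _ _); lra. }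
assert (T3 : Cmod (0, v) <= Rabs v).
{ apply Rle_trans with (1 := Cmod_pair _ _); rewrite Rabs_R0; lra. }
apply Rle_trans with (1 := Cmod_triangle _ _).
apply Rle_trans with (Cmod (RtoC de * (cos v, sin v)) +
  (Cmod (RtoC (1 + u) * (dc, ds))
   + Cmod (RtoC u * (0, v)))).
{ apply Rplus_le_compat_l, Cmod_triangle. }
rewrite !Cmod_mult, !Cmod_R, T1.
assert (T4 : Rabs (1 + u) <= 2).
{ apply Rle_trans with (1 := Rabs_triang _ _); rewrite Rabs_R1; lra. }
pose proof (Rabs_pos u); pose proof (Rabs_pos v); pose proof (Rabs_pos (1 + u)).
pose proof (Cmod_ge_0 (dc, ds)).
pose proof (Cmod_ge_0 (0, v)).
assert (Rabs (1 + u) * Cmod (dc, ds)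
         <= 2 * (2 * e * Rabs v)) by (apply Rmult_le_compat; lra).
assert (Rabs u * Cmod (0, v) <= e * Rabs v) by (apply Rmult_le_compat; lra).
nra.
Qed.

Lemma is_cderive_cexp (z : C) : is_cderive cexp z (cexp z).
Proof.
apply is_cderive_iff; intros eps He.
pose proof (Cmod_cexp z) as E; pose proof (exp_pos (fst z)) as P.
destruct (proj1 (is_cderive_iff _ _ _) is_cderive_cexp_0 (eps / exp (fst z)))
  as [d [Hd H]]; [apply Rdiv_lt_0_compat; lra|].
exists d; split; [exact Hd|]; intros h Hh; specialize (H h Hh).
replace (cexp (z + h)%C - cexp z - cexp z * h)%C
  with (cexp z * (cexp (RtoC 0 + h)%C - cexp (RtoC 0) - RtoC 1 * h))%C.
2:{ rewrite (cexp_plus z h), Cplus_0_l.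
    replace (cexp (RtoC 0)) with (RtoC 1).
    - ring.
    - unfold cexp, RtoC; simpl; rewrite exp_0, cos_0, sin_0; f_equal; ring. }
rewrite Cmod_mult, E.
apply Rmult_le_compat_l with (r := exp (fst z)) in H; [|lra].
replace (exp (fst z) * (eps / exp (fst z) * Cmod h)) with (eps * Cmod h) in H
  by (field; lra).
exact H.
Qed.

(** C over itself carries two normed-module structures, whose topologies come from
    the product and from the modulus.  A derivative only involves the norm, which
    they share, but the rules for products and compositions are stated for the
    second one. *)
Lemma is_cderive_ring (f : C -> C) (z l : C) :
  is_cderive f z l <->
  is_derive (K := C_AbsRing) (V := AbsRing_NormedModule C_AbsRing) f z l.
Proof.
split; intros [_ H]; split; try exact H.
- apply (is_linear_scal_l (V := AbsRing_NormedModule C_AbsRing)).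
- apply (is_linear_scal_l (V := C_NormedModule)).
Qed.

Lemma is_cderive_plus (f g : C -> C) (z l m : C) :
  is_cderive f z l -> is_cderive g z m ->
  is_cderive (fun w => f w + g w)%C z (l + m)%C.
Proof. apply (is_derive_plus (V := C_NormedModule)). Qed.

Lemma is_cderive_minus (f g : C -> C) (z l m : C) :
  is_cderive f z l -> is_cderive g z m ->
  is_cderive (fun w => f w - g w)%C z (l - m)%C.
Proof. apply (is_derive_minus (V := C_NormedModule)). Qed.

Lemma is_cderive_mult (f g : C -> C) (z l m : C) :
  is_cderive f z l -> is_cderive g z m ->
  is_cderive (fun w => f w * g w)%C z (l * g z + f z * m)%C.
Proof.
intros Hf Hg; apply is_cderive_ring.
apply (is_derive_mult (K := C_AbsRing) f g z l m);
  [now apply is_cderive_ring|now apply is_cderive_ring|exact Cmult_comm].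
Qed.

Lemma is_cderive_comp (f g : C -> C) (z l m : C) :
  is_cderive f (g z) l -> is_cderive g z m ->
  is_cderive (fun w => f (g w)) z (m * l)%C.
Proof.
intros Hf Hg; apply (is_derive_comp (K := C_AbsRing) (V := C_NormedModule));
  [exact Hf|now apply is_cderive_ring].
Qed.

Lemma is_cderive_const (c z : C) : is_cderive (fun _ => c) z (RtoC 0).
Proof. apply (is_derive_const (V := C_NormedModule)). Qed.

Lemma is_cderive_id (z : C) : is_cderive (fun w => w) z (RtoC 1).
Proof. apply is_cderive_ring, (is_derive_id (K := C_AbsRing)). Qed.

Lemma is_cderive_shift (f : C -> C) (h z l : C) :
  is_cderive f (z + h)%C l -> is_cderive (fun w => f (w + h)%C) z l.
Proof.
intros H.
replace l with ((RtoC 1 + RtoC 0) * l)%C by ring.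
apply (is_cderive_comp f (fun w => (w + h)%C)); [exact H|].
apply is_cderive_plus; [apply is_cderive_id|apply is_cderive_const].
Qed.

Lemma is_cderive_opp_id (z : C) : is_cderive (fun w => - w)%C z (- RtoC 1)%C.
Proof. apply (is_derive_opp (V := C_NormedModule)), is_cderive_id. Qed.

Lemma is_cderive_cexp_opp (z : C) :
  is_cderive (fun w => cexp (- w)%C) z (- cexp (- z))%C.
Proof.
replace (- cexp (- z))%C with (- RtoC 1 * cexp (- z))%C by ring.
apply (is_cderive_comp cexp Copp); [apply is_cderive_cexp|].
apply is_cderive_opp_id.
Qed.

(** The integrand is g(s + i t) i with g(zeta) = f(z + e^zeta) e^(-zeta).  By
    Goursat's theorem and the periodicity of g its integral is the same at every
    abscissa x <= s.  As x tends to -infinity, f(z + e^zeta) e^(-zeta) is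
    f(z) e^(-zeta) + l + o(1), and the term f(z) e^(-zeta) has integral zero,
    because its primitive is periodic. *)
Theorem cauchy_formula_derivative (f : C -> C) (z l : C) (s : R) :
  (forall w, Cmod (w - z) <= exp s -> cdiff f w) ->
  is_cderive f z l ->
  is_CInt (fun t => f (z + cexp (s, t))%C * cexp (- (s, t)) * Ci)%C
    0 (2 * PI) (RtoC (2 * PI) * (l * Ci))%C.
Proof.
intros Hf Hl.
pose proof PI_RGT_0 as HPI.
set (g := fun w : C => (f (z + cexp w)%C * cexp (- w))%C).
assert (Hg : forall x y, x <= s -> cdiff g (x, y)).
{ intros x y Hx.
  destruct (Hf (z + cexp (x, y))%C) as [m Hm].
  { replace (z + cexp (x, y) - z)%C with (cexp (x, y)) by ring.
    rewrite Cmod_cexp; simpl.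
    destruct Hx as [Hx| ->]; [left; now apply exp_increasing|lra]. }
  eexists; apply is_cderive_mult; [|apply is_cderive_cexp_opp].
  apply (is_cderive_comp f (fun w => (z + cexp w)%C)); [exact Hm|].
  apply is_cderive_plus; [apply is_cderive_const|apply is_cderive_cexp]. }
set (I := fun x => ver_int g x 0 (2 * PI)).
assert (HI : forall x, x <= s ->
   is_CInt (fun t => g (x, t) * Ci)%C 0 (2 * PI) (I x)).
{ intros x Hx; apply is_CInt_ver; auto. }
assert (Iconst : forall x, x <= s -> I x = I s).
{ intros x Hx.
  assert (G : rect_int g x s 0 (2 * PI) = RtoC 0)
    by (apply goursat; try lra; intros; apply Hg; lra).
  unfold rect_int in G; fold (I x) (I s) in G.
  replace (hor_int g (2 * PI) x s) with (hor_int g 0 x s) in G.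
  - transitivity (I x + RtoC 0)%C; [ring|rewrite <- G; ring].
  - apply (RInt_ext (V := C_R_CompleteNormedModule)); intros t _.
    unfold g; now rewrite cexp_2PI, cexp_opp_2PI. }
assert (K : I s = (RtoC (2 * PI) * (l * Ci))%C).
{ assert (KK : forall eps, 0 < eps ->
    Cmod (I s - RtoC (2 * PI) * (l * Ci)) <= 2 * PI * eps).
  { intros eps He.
    destruct (proj1 (is_cderive_iff _ _ _) Hl eps He) as [d [Hd H]].
    (* An abscissa at which the circle has radius less than [d]. *)
    set (x := Rmin s (ln d - 1)).
    assert (Hx : x <= s) by apply Rmin_l.
    assert (Hxd : exp x < d).
    { rewrite <- (exp_ln d) by exact Hd; apply exp_increasing.
      pose proof (Rmin_r s (ln d - 1)); unfold x; lra. }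
    rewrite <- (Iconst x Hx).
    assert (HW : is_CInt (fun t => f z * (cexp (- (x, t)) * Ci))%C 0 (2 * PI)
                  (RtoC 0)).
    { replace (RtoC 0) with
        (- (f z * cexp (- (x, (2 * PI)%R))) - - (f z * cexp (- (x, 0%R))))%C.
      - apply (is_RInt_ext (V := C_R_NormedModule)
          (fun t => (f z * cexp (- (x, t))) * Ci)%C).
        { intros t _; rewrite Cmult_assoc; reflexivity. }
        apply (is_CInt_comp_derive (fun w => - (f z * cexp (- w)))%C
                 (fun w => f z * cexp (- w))%C
                 (fun t => (x, t)) (fun _ => Ci)).
        + intros t _.
          replace (f z * cexp (- (x, t)))%C
            with (- (RtoC 0 * cexp (- (x, t)) + f z * - cexp (- (x, t))))%C by ring.
          apply (is_derive_opp (V := C_NormedModule)).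
          apply (is_cderive_mult (fun _ => f z) (fun w => cexp (- w)%C)).
          * apply is_cderive_const.
          * apply is_cderive_cexp_opp.
        + intros; apply is_rderive_ver.
        + intros t _; apply (ccontinuous_ver (fun w => f z * cexp (- w))%C).
          eexists; apply is_cderive_mult;
            [apply is_cderive_const|apply is_cderive_cexp_opp].
        + intros; apply ccontinuous_const.
      - rewrite cexp_opp_2PI; ring. }
    pose proof (is_CInt_minus _ _ _ _ _ _
      (is_CInt_minus _ _ _ _ _ _ (HI x Hx) (is_CInt_const 0 (2 * PI) (l * Ci)%C))
      HW) as HM.
    replace (I x - RtoC (2 * PI) * (l * Ci))%C with
      (I x - RtoC (2 * PI - 0) * (l * Ci) - RtoC 0)%C
      by (rewrite Rminus_0_r; ring).
    replace (2 * PI * eps) with (eps * Rabs (2 * PI - 0))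
      by (rewrite Rminus_0_r, Rabs_pos_eq by lra; ring).
    apply Cmod_CInt_le with (2 := HM); intros t _.
    specialize (H (cexp (x, t))); rewrite Cmod_cexp in H; simpl in H.
    specialize (H Hxd).
    unfold g.
    match goal with |- Cmod ?e <= _ => replace e with
      ((f (z + cexp (x, t))%C - f z - l * cexp (x, t)) * cexp (- (x, t)) * Ci)%C end.
    2:{ transitivity (f (z + cexp (x, t))%C * cexp (- (x, t)) * Ci
          - f z * (cexp (- (x, t)) * Ci)
          - l * Ci * (cexp (x, t) * cexp (- (x, t))))%C; [ring|].
        rewrite cexp_opp; ring. }
    rewrite !Cmod_mult, Cmod_Ci, Cmod_cexp; simpl.
    rewrite exp_Ropp; pose proof (exp_pos x).
    apply Rmult_le_compat_r with (r := / exp x) in H;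
      [|left; now apply Rinv_0_lt_compat].
    rewrite Rmult_assoc, Rinv_r, Rmult_1_r in H by lra; lra. }
  assert (Cmod (I s - RtoC (2 * PI) * (l * Ci)) = 0).
  { apply Rle_antisym; [|apply Cmod_ge_0].
    apply le_epsilon; intros e He.
    specialize (KK (e / (2 * PI)) ltac:(apply Rdiv_lt_0_compat; lra)).
    replace (2 * PI * (e / (2 * PI))) with e in KK by (field; lra); lra. }
  apply Cmod_eq_0 in H.
  transitivity (RtoC (2 * PI) * (l * Ci) + RtoC 0)%C; [rewrite <- H; ring|ring]. }
rewrite <- K; apply HI; lra.
Qed.

Lemma is_cderive_C_derive (f : C -> C) (z : C) :
  cdiff f z -> is_cderive f z (C_derive f z).
Proof. apply C_derive_correct; exact z. Qed.

Lemma cauchy_estimate (f : C -> C) (z l : C) (r M : R) :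
  0 < r ->
  (forall w, Cmod (w - z) <= r -> cdiff f w /\ Cmod (f w) <= M) ->
  is_cderive f z l -> Cmod l <= M / r.
Proof.
intros Hr Hf Hl.
pose proof PI_RGT_0 as HPI.
assert (Er : exp (ln r) = r) by now apply exp_ln.
assert (HI := cauchy_formula_derivative f z l (ln r)).
rewrite Er in HI; specialize (HI (fun w Hw => proj1 (Hf w Hw)) Hl).
apply Cmod_CInt_le with (M := M / r) in HI.
- rewrite !Cmod_mult, Cmod_Ci, Cmod_R, Rminus_0_r, Rmult_1_r in HI.
  rewrite Rabs_pos_eq in HI by lra.
  apply Rmult_le_reg_l with (2 * PI); lra.
- intros t _; rewrite !Cmod_mult, Cmod_Ci, Cmod_cexp, Rmult_1_r; simpl.
  rewrite exp_Ropp, Er; apply Rmult_le_compat_r.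
  + left; now apply Rinv_0_lt_compat.
  + apply Hf.
    replace (z + cexp (ln r, t) - z)%C with (cexp (ln r, t)) by ring.
    rewrite Cmod_cexp; simpl; lra.
Qed.

Lemma is_CInt_mult_const (g : R -> C) (a b : R) (v h : C) :
  is_CInt g a b v -> is_CInt (fun t => g t * h)%C a b (v * h)%C.
Proof.
intros H.
pose proof (is_RInt_fct_extend_fst (U := R_NormedModule) (V := R_NormedModule)
  g a b v H) as H1.
pose proof (is_RInt_fct_extend_snd (U := R_NormedModule) (V := R_NormedModule)
  g a b v H) as H2.
apply (is_RInt_fct_extend_pair (U := R_NormedModule) (V := R_NormedModule));
  unfold Cmult; simpl.
- apply (is_RInt_ext (V := R_NormedModule) (fun t => fst h * fst (g t) - snd h * snd (g t)));
    [intros t _; simpl; ring|].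
  replace (fst v * fst h - snd v * snd h) with (fst h * fst v - snd h * snd v) by ring.
  apply (is_RInt_minus (V := R_NormedModule));
    apply (is_RInt_scal (V := R_NormedModule)); assumption.
- apply (is_RInt_ext (V := R_NormedModule) (fun t => snd h * fst (g t) + fst h * snd (g t)));
    [intros t _; simpl; ring|].
  replace (fst v * snd h + snd v * fst h) with (snd h * fst v + fst h * snd v) by ring.
  apply (is_RInt_plus (V := R_NormedModule));
    apply (is_RInt_scal (V := R_NormedModule)); assumption.
Qed.

(** * Derivatives of all orders *)

(** Cauchy's inequality is applied to w |-> f(w + h) - f(w), which is O(h) because
    f' is bounded, again by Cauchy's inequality. *)
Lemma C_derive_lipschitz (f : C -> C) (z0 : C) (R M : R) :
  0 < R ->
  (forall w, Cmod (w - z0) < R -> cdiff f w /\ Cmod (f w) <= M) ->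
  forall z h, Cmod (z - z0) <= R / 4 -> Cmod h <= R / 8 ->
    Cmod (C_derive f (z + h) - C_derive f z) <= M / (R / 4) / (R / 8) * Cmod h.
Proof.
intros HR Hf z h Hz Hh.
assert (L1 : forall w, Cmod (w - z0) <= R / 2 -> Cmod (C_derive f w) <= M / (R / 4)).
{ intros w Hw; apply (cauchy_estimate f w _ (R / 4)); [lra| |].
  - intros v Hv; apply Hf.
    replace (v - z0)%C with ((v - w) + (w - z0))%C by ring.
    apply Rle_lt_trans with (1 := Cmod_triangle _ _); lra.
  - apply is_cderive_C_derive, Hf; lra. }
set (phi := fun w => (f (w + h)%C - f w)%C).
assert (Hin : forall w t, Cmod (w - z) <= R / 8 -> 0 <= t <= 1 ->
   Cmod (w + RtoC t * h - z0) <= R / 2).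
{ intros w t Hw Ht.
  replace (w + RtoC t * h - z0)%C with ((w - z) + ((z - z0) + RtoC t * h))%C by ring.
  apply Rle_trans with (1 := Cmod_triangle _ _).
  apply Rle_trans with (Cmod (w - z) + (Cmod (z - z0) + Cmod (RtoC t * h))).
  { apply Rplus_le_compat_l, Cmod_triangle. }
  rewrite Cmod_mult, Cmod_R, Rabs_pos_eq by lra.
  pose proof (Cmod_ge_0 h); nra. }
assert (Hd : forall w, Cmod (w - z) <= R / 8 ->
   is_cderive phi w (C_derive f (w + h) - C_derive f w)%C).
{ intros w Hw; apply is_cderive_minus.
  - apply is_cderive_shift, is_cderive_C_derive, Hf.
    specialize (Hin w 1 Hw ltac:(lra)).
    replace (w + RtoC 1 * h - z0)%C with (w + h - z0)%C in Hin by ring; lra.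
  - apply is_cderive_C_derive, Hf.
    specialize (Hin w 0 Hw ltac:(lra)).
    replace (w + RtoC 0 * h - z0)%C with (w - z0)%C in Hin by ring; lra. }
replace (M / (R / 4) / (R / 8) * Cmod h) with (M / (R / 4) * Cmod h / (R / 8))
  by (field; lra).
apply (cauchy_estimate phi z _ (R / 8)); [lra| |].
- intros w Hw; split; [eexists; apply Hd, Hw|].
  unfold phi; replace (Cmod h) with (Cmod (w + h - w)) by (f_equal; ring).
  apply Cmod_mean_value; intros t Ht.
  exists (C_derive f (w + RtoC t * (w + h - w))%C).
  specialize (Hin w t Hw Ht).
  replace (w + RtoC t * (w + h - w))%C with (w + RtoC t * h)%C by ring.
  split; [|now apply L1].
  apply is_cderive_C_derive, Hf; lra.
- apply Hd.
  replace (z - z)%C with (RtoC 0) by ring; rewrite Cmod_0; lra.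
Qed.

(** The mean value inequality for w |-> f(w) - f'(z) w. *)
Lemma taylor1_bound (f : C -> C) (z h : C) (L : R) :
  0 <= L ->
  (forall t, 0 <= t <= 1 -> cdiff f (z + RtoC t * h)%C /\
     Cmod (C_derive f (z + RtoC t * h) - C_derive f z) <= L * Cmod h) ->
  Cmod (f (z + h)%C - f z - C_derive f z * h) <= L * Cmod h ^ 2.
Proof.
intros HL H.
set (g := fun w => (f w - C_derive f z * w)%C).
replace (f (z + h)%C - f z - C_derive f z * h)%C with (g (z + h) - g z)%C
  by (unfold g; ring).
replace (L * Cmod h ^ 2) with (L * Cmod h * Cmod (z + h - z))
  by (replace (z + h - z)%C with h by ring; ring).
apply Cmod_mean_value; intros t Ht.
replace (z + h - z)%C with h by ring.
destruct (H t Ht) as [H1 H2].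
eexists; split; [|exact H2].
apply is_cderive_minus; [now apply is_cderive_C_derive|].
replace (C_derive f z) with
  (RtoC 0 * (z + RtoC t * h) + C_derive f z * RtoC 1)%C at 2 by ring.
apply (is_cderive_mult (fun _ => C_derive f z) (fun w => w));
  [apply is_cderive_const|apply is_cderive_id].
Qed.

Definition c_open (U : C -> Prop) : Prop :=
  forall z, U z -> exists delta, 0 < delta /\
    forall h, Cmod h < delta -> U (z + h)%C.

(** Cauchy's formula at z0 + h and at z0, with the same radius, expresses
    f'(z0 + h) - f'(z0) as an integral of f(w + h) - f(w) over the circle.  By
    [taylor1_bound] this difference is f'(w) h up to O(h^2), uniformly on the
    circle, so f' is differentiable at z0 and its derivative is Cauchy's integral
    of f'. *)
Theorem C_derive_differentiable (U : C -> Prop) (f : C -> C) :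
  c_open U -> (forall z, U z -> cdiff f z) ->
  forall z, U z -> cdiff (C_derive f) z.
Proof.
intros Uopen Hf z0 Uz.
pose proof PI_RGT_0 as HPI.
destruct (Uopen z0 Uz) as [d0 [Hd0 HU]].
destruct (Hf z0 Uz) as [l Hl].
destruct (is_cderive_continuous f z0 l Hl 1 Rlt_0_1) as [d1 [Hd1 Hc]].
set (R := Rmin d0 d1); assert (HR : 0 < R) by (apply Rmin_pos; assumption).
set (M := Cmod (f z0) + 1).
assert (HM : 0 <= M) by (pose proof (Cmod_ge_0 (f z0)); unfold M; lra).
assert (HfR : forall w, Cmod (w - z0) < R -> cdiff f w /\ Cmod (f w) <= M).
{ intros w Hw; replace w with (z0 + (w - z0))%C by ring; split.
  - apply Hf, HU; apply Rlt_le_trans with (1 := Hw), Rmin_l.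
  - pose proof (Hc (w - z0)%C (Rlt_le_trans _ _ _ Hw (Rmin_r _ _))) as E.
    pose proof (Cmod_minus_ge (f (z0 + (w - z0))%C) (f z0)); unfold M; lra. }
pose proof (C_derive_lipschitz f z0 R M HR HfR) as Lip.
set (L := M / (R / 4) / (R / 8)) in *.
assert (HL : 0 <= L).
{ unfold L; repeat apply Rdiv_le_0_compat; lra. }
set (s := ln (R / 8)).
assert (Es : exp s = R / 8) by (apply exp_ln; lra).
assert (Hcirc : forall t, Cmod (z0 + cexp (s, t) - z0) <= R / 8).
{ intros t; replace (z0 + cexp (s, t) - z0)%C with (cexp (s, t)) by ring.
  rewrite Cmod_cexp; simpl; lra. }
assert (Hkcont : forall t, ccontinuous (fun t => cexp (s, t)) t).
{ intros t; apply ccontinuous_ver; eexists; apply is_cderive_cexp. }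
(* The integrand of the derivative, up to the factor 2 i pi. *)
set (k := fun t => (C_derive f (z0 + cexp (s, t)) * cexp (- (s, t)) * Ci)%C).
assert (Hk : ex_CInt k 0 (2 * PI)).
{ apply (ex_RInt_continuous (V := C_R_CompleteNormedModule)); intros t _.
  apply ccontinuous_mult; [|apply ccontinuous_const].
  apply ccontinuous_mult.
  - apply ccontinuous_iff; intros eps He.
    destruct (proj1 (ccontinuous_iff _ _) (Hkcont t)
      (Rmin (R / 8) (eps / (L + 1)))) as [d [Hd H]].
    { apply Rmin_pos; [lra|]; apply Rdiv_lt_0_compat; lra. }
    exists d; split; [exact Hd|]; intros u Hu; specialize (H u Hu).
    assert (E1 : Cmod (cexp (s, u) - cexp (s, t)) < R / 8)
      by (eapply Rlt_le_trans; [exact H|apply Rmin_l]).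
    assert (E2 : Cmod (cexp (s, u) - cexp (s, t)) < eps / (L + 1))
      by (eapply Rlt_le_trans; [exact H|apply Rmin_r]).
    specialize (Lip (z0 + cexp (s, t))%C (cexp (s, u) - cexp (s, t))%C).
    replace (z0 + cexp (s, t) + (cexp (s, u) - cexp (s, t)))%C
      with (z0 + cexp (s, u))%C in Lip by ring.
    specialize (Hcirc t).
    apply Rle_lt_trans with (1 := Lip ltac:(lra) ltac:(lra)).
    apply Rmult_lt_compat_r with (r := L + 1) in E2; [|lra].
    replace (eps / (L + 1) * (L + 1)) with eps in E2 by (field; lra).
    pose proof (Cmod_ge_0 (cexp (s, u) - cexp (s, t))); nra.
  - apply (ccontinuous_ver (fun w => cexp (- w)%C)).
    eexists; apply is_cderive_cexp_opp. }
destruct Hk as [v Hv].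
assert (N0 : RtoC (2 * PI) <> RtoC 0) by (intros E; injection E; lra).
assert (Ni : Ci <> RtoC 0) by (intros E; injection E; lra).
exists (v / (RtoC (2 * PI) * Ci))%C.
apply is_cderive_iff; intros eps He.
set (Q := L / (R / 8)).
assert (HQ : 0 <= Q) by (apply Rdiv_le_0_compat; lra).
exists (Rmin (R / 8) (eps / (Q + 1))); split.
{ apply Rmin_pos; [lra|]; apply Rdiv_lt_0_compat; lra. }
intros h Hh.
assert (Hh1 : Cmod h < R / 8) by (eapply Rlt_le_trans; [exact Hh|apply Rmin_l]).
assert (Hh2 : Cmod h < eps / (Q + 1)) by (eapply Rlt_le_trans; [exact Hh|apply Rmin_r]).
assert (I1 := cauchy_formula_derivative (fun w => f (w + h)%C) z0
  (C_derive f (z0 + h)) s).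
assert (I2 := cauchy_formula_derivative f z0 (C_derive f z0) s).
assert (J1 := fun H1 H2 => is_CInt_minus _ _ _ _ _ _
  (is_CInt_minus _ _ _ _ _ _ (I1 H1 (is_cderive_shift _ _ _ _ H2)) (I2 (fun w Hw => proj1 (HfR w ltac:(lra)))
    (is_cderive_C_derive _ _ (Hf z0 Uz))))
  (is_CInt_mult_const _ _ _ _ h Hv)).
assert (Cmod (RtoC (2 * PI) * (C_derive f (z0 + h) * Ci) - RtoC (2 * PI) * (C_derive f z0 * Ci) - v * h) <= Q * Cmod h ^ 2 * Rabs (2 * PI - 0)) as B.
{ eapply Cmod_CInt_le; [|apply J1].
  - intros t _; cbv beta.
    match goal with |- Cmod ?e <= _ => replace e with
      ((f (z0 + cexp (s, t) + h)%C - f (z0 + cexp (s, t))%C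
        - C_derive f (z0 + cexp (s, t)) * h) * (cexp (- (s, t)) * Ci))%C end.
    2:{ unfold k; ring. }
    rewrite Cmod_mult, (Cmod_mult (cexp _)), Cmod_Ci, Cmod_cexp, Rmult_1_r; simpl fst.
    rewrite exp_Ropp, Es.
    replace (Q * Cmod h ^ 2) with (L * Cmod h ^ 2 * / (R / 8))
      by (unfold Q; field; lra).
    apply Rmult_le_compat_r; [left; apply Rinv_0_lt_compat; lra|].
    apply taylor1_bound; [exact HL|]; intros u Hu.
    assert (Hs : Cmod (RtoC u * h) <= Cmod h).
    { rewrite Cmod_mult, Cmod_R, Rabs_pos_eq by lra.
      pose proof (Cmod_ge_0 h); nra. }
    specialize (Hcirc t); split.
    + apply HfR.
      replace (z0 + cexp (s, t) + RtoC u * h - z0)%C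
        with ((z0 + cexp (s, t) - z0) + RtoC u * h)%C by ring.
      apply Rle_lt_trans with (1 := Cmod_triangle _ _); lra.
    + apply Rle_trans with (L * Cmod (RtoC u * h)); [apply Lip; lra|].
      apply Rmult_le_compat_l; lra.
  - intros w Hw.
    destruct (HfR (w + h)%C) as [[m Hm] _].
    { replace (w + h - z0)%C with ((w - z0) + h)%C by ring.
      apply Rle_lt_trans with (1 := Cmod_triangle _ _); lra. }
    exists m; apply is_cderive_shift, Hm.
  - apply is_cderive_C_derive, HfR.
    replace (z0 + h - z0)%C with h by ring; lra. }
rewrite Rminus_0_r, Rabs_pos_eq in B by lra.
replace (RtoC (2 * PI) * (C_derive f (z0 + h) * Ci)
         - RtoC (2 * PI) * (C_derive f z0 * Ci) - v * h)%C with
  ((C_derive f (z0 + h) - C_derive f z0 - v / (RtoC (2 * PI) * Ci) * h)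
   * (RtoC (2 * PI) * Ci))%C in B by (field; auto).
rewrite Cmod_mult, (Cmod_mult (RtoC _)), Cmod_Ci, Cmod_R, Rmult_1_r in B.
rewrite Rabs_pos_eq in B by lra.
apply Rmult_le_reg_r in B; [|lra].
apply Rle_trans with (1 := B).
apply Rmult_lt_compat_r with (r := Q + 1) in Hh2; [|lra].
replace (eps / (Q + 1) * (Q + 1)) with eps in Hh2 by (field; lra).
pose proof (Cmod_ge_0 h).
replace (Q * Cmod h ^ 2) with (Q * Cmod h * Cmod h) by ring.
apply Rmult_le_compat_r; [lra|]; nra.
Qed.

Definition C_derive_n (n : nat) (f : C -> C) : C -> C := Nat.iter n C_derive f.

Lemma C_derive_n_differentiable (U : C -> Prop) (f : C -> C) (n : nat) :
  c_open U -> (forall z, U z -> cdiff f z) ->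
  forall z, U z -> cdiff (C_derive_n n f) z.
Proof.
intros Uopen Hf; induction n as [|n IH]; [exact Hf|].
exact (C_derive_differentiable U _ Uopen IH).
Qed.

(** Each differentiation gives up a disc of radius r / m, so that m of them
    exhaust the radius r. *)
Lemma C_derive_n_bound (U : C -> Prop) (f : C -> C) (z : C) (r M : R) (m : nat) :
  c_open U -> (forall w, U w -> cdiff f w) -> 0 < r ->
  (forall w, Cmod (w - z) <= r -> U w /\ Cmod (f w) <= M) ->
  Cmod (C_derive_n m f z) <= M * (INR m / r) ^ m.
Proof.
intros Uopen Hf Hr H.
destruct m as [|m0].
{ simpl; rewrite Rmult_1_r; apply H.
  replace (z - z)%C with (RtoC 0) by ring; rewrite Cmod_0; lra. }
set (m := S m0).
assert (Hm : 0 < INR m) by (apply lt_0_INR; unfold m; lia).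
clearbody m.
assert (G : forall j, (j <= m)%nat -> forall w,
  Cmod (w - z) <= r * (INR m - INR j) / INR m ->
  Cmod (C_derive_n j f w) <= M * (INR m / r) ^ j).
{ induction j as [|j IH]; intros Hj w Hw.
  - simpl; rewrite Rmult_1_r; apply H.
    simpl in Hw; replace (r * (INR m - 0) / INR m) with r in Hw by (field; lra).
    exact Hw.
  - assert (Hj' : INR (S j) <= INR m) by now apply le_INR.
    assert (Hrm : 0 < r / INR m) by (apply Rdiv_lt_0_compat; lra).
    replace (M * (INR m / r) ^ S j) with (M * (INR m / r) ^ j / (r / INR m))
      by (simpl; field; lra).
    rewrite S_INR in Hw, Hj'.
    assert (Hin : forall v, Cmod (v - w) <= r / INR m ->
       Cmod (v - z) <= r * (INR m - INR j) / INR m).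
    { intros v Hv; replace (v - z)%C with ((v - w) + (w - z))%C by ring.
      apply Rle_trans with (1 := Cmod_triangle _ _).
      replace (r * (INR m - INR j) / INR m) with
        (r / INR m + r * (INR m - (INR j + 1)) / INR m) by (field; lra); lra. }
    assert (Hr' : forall v, Cmod (v - w) <= r / INR m -> Cmod (v - z) <= r).
    { intros v Hv; apply Rle_trans with (1 := Hin v Hv).
      pose proof (pos_INR j).
      apply Rmult_le_reg_r with (INR m); [lra|].
      unfold Rdiv; rewrite Rmult_assoc, Rinv_l by lra; nra. }
    apply (cauchy_estimate (C_derive_n j f) w _ (r / INR m)); [exact Hrm| |].
    + intros v Hv; split.
      * apply (C_derive_n_differentiable U); auto; apply H; auto.
      * apply IH; [lia|]; auto.
    + apply is_cderive_C_derive, (C_derive_n_differentiable U); auto.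
      apply H, Hr'.
      replace (w - w)%C with (RtoC 0) by ring; rewrite Cmod_0; lra. }
apply (G m (le_n m)).
replace (z - z)%C with (RtoC 0) by ring; rewrite Cmod_0, Rminus_diag.
unfold Rdiv; rewrite Rmult_0_r, Rmult_0_l; lra.
Qed.

(** * Neighbourhoods of the segment *)

Lemma seg_nbhd_pos (r : R) (z : C) : seg_nbhd r z -> 0 < r.
Proof. intros [x [w [_ [H _]]]]; pose proof (Cmod_ge_0 w); lra. Qed.

Lemma seg_nbhd_le (r r' : R) (z : C) : r <= r' -> seg_nbhd r z -> seg_nbhd r' z.
Proof.
intros Hr [x [w [Hx [Hw ->]]]]; exists x, w; repeat split; [apply Hx|apply Hx|lra].
Qed.

Lemma seg_nbhd_open (r : R) : c_open (seg_nbhd r).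
Proof.
intros z [x [w [Hx [Hw ->]]]]; exists (r - Cmod w); split; [lra|]; intros h Hh.
exists x, (w + h)%C; split; [exact Hx|]; split; [|ring].
apply Rle_lt_trans with (1 := Cmod_triangle _ _); lra.
Qed.

Lemma Cmod_le_fst_snd (z w : C) :
  Rabs (fst z) <= Rabs (fst w) -> Rabs (snd z) <= Rabs (snd w) -> Cmod z <= Cmod w.
Proof.
intros H1 H2; unfold Cmod; apply sqrt_le_1_alt.
apply Rplus_le_compat; rewrite <- !Rsqr_pow2; now apply Rsqr_le_abs_1.
Qed.

Lemma seg_nbhd_vertical (r x y y' : R) :
  seg_nbhd r (x, y) -> Rabs y' <= Rabs y -> seg_nbhd r (x, y').
Proof.
intros [s [w [Hs [Hw E]]]] Hy.
exists s, (x - s, y'); split; [exact Hs|]; split.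
- apply Rle_lt_trans with (2 := Hw).
  assert (Ew : w = (x - s, y)).
  { replace w with ((x, y) - RtoC s)%C by (rewrite E; ring).
    apply injective_projections; simpl; ring. }
  rewrite Ew; apply Cmod_le_fst_snd; simpl; lra.
- apply injective_projections; simpl; ring.
Qed.

Lemma seg_nbhd_horizontal (r x x' y : R) :
  seg_nbhd r (x, y) -> Rmin 0 x <= x' <= Rmax 0 x -> seg_nbhd r (x', 0).
Proof.
intros [s [w [Hs [Hw E]]]] Hx.
assert (Hd : Rabs (x - s) < r).
{ apply Rle_lt_trans with (2 := Hw).
  replace (x - s) with (Re w); [apply re_le_Cmod|].
  apply (f_equal fst) in E; simpl in E; unfold Re; lra. }
assert (K : exists s', seg s' /\ Rabs (x' - s') < r).
{ unfold seg in *; exists (Rmax (-1) (Rmin 1 x')).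
  revert Hx Hd; unfold Rmax, Rmin, Rabs; repeat destruct Rle_dec;
    repeat destruct Rcase_abs; lra. }
destruct K as [s' [Hs' Hr]]; exists s', (RtoC (x' - s')).
split; [exact Hs'|]; split; [now rewrite Cmod_R|].
apply injective_projections; simpl; ring.
Qed.

Lemma seg_nbhd_primitive (r : R) (g : C -> C) :
  (forall z, seg_nbhd r z -> cdiff g z) ->
  exists G : C -> C, forall z, seg_nbhd r z -> is_cderive G z (g z).
Proof.
apply exists_primitive.
- apply seg_nbhd_open.
- apply seg_nbhd_vertical.
- apply seg_nbhd_horizontal.
Qed.

(** Local bounds are made uniform by a Lebesgue number of a cover of [-1, 1].  The
    radius delta t of the interval around t is also chosen to satisfy
    |f| <= 1 / delta t nearby, so a lower bound on the radii bounds f as well. *)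
Lemma bounded_near_seg (mu : R) (f : C -> C) :
  0 < mu -> (forall z, seg_nbhd mu z -> cdiff f z) ->
  exists rho M, 0 < rho <= mu /\ forall z, seg_nbhd rho z -> Cmod (f z) <= M.
Proof.
intros Hmu Hf.
assert (L : forall t, exists d : posreal, seg t ->
   forall z, Cmod (z - RtoC t) < 2 * d -> Cmod (f z) <= / d).
{ intros t; destruct (classic (seg t)) as [St|St];
    [|exists (mkposreal 1 Rlt_0_1); contradiction].
  destruct (Hf _ (seg_nbhd_RtoC mu t Hmu St)) as [l Hl].
  destruct (is_cderive_continuous _ _ _ Hl 1 Rlt_0_1) as [d [Hd H]].
  pose proof (Cmod_ge_0 (f (RtoC t))) as Hp.
  set (B := Cmod (f (RtoC t)) + 1) in *.
  assert (He : 0 < Rmin (d / 2) (/ B)).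
  { apply Rmin_pos; [lra|apply Rinv_0_lt_compat; unfold B; lra]. }
  exists (mkposreal _ He); intros _ z Hz; simpl in *.
  pose proof (Rmin_l (d / 2) (/ B)); pose proof (Rmin_r (d / 2) (/ B)).
  specialize (H (z - RtoC t)%C ltac:(lra)).
  replace (RtoC t + (z - RtoC t))%C with z in H by ring.
  pose proof (Cmod_minus_ge (f z) (f (RtoC t))).
  apply Rle_trans with B; [unfold B; lra|].
  apply Rle_trans with (/ / B); [rewrite Rinv_inv; lra|].
  now apply Rinv_le_contravar. }
set (delta := fun t =>
  proj1_sig (constructive_indefinite_description _ (L t))).
assert (Hdelta : forall t, seg t ->
   forall z, Cmod (z - RtoC t) < 2 * delta t -> Cmod (f z) <= / delta t)
  by (intros t; exact (proj2_sig (constructive_indefinite_description _ (L t)))).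
clearbody delta.
destruct (compactness_value_1d (-1) 1 delta) as [d Hd].
exists (Rmin d mu), (/ d); split.
{ split; [apply Rmin_pos; [apply cond_pos|exact Hmu]|apply Rmin_r]. }
intros z [x [w [Sx [Hw ->]]]].
apply NNPP; intros N; apply (Hd x Sx); intros [t [St [Hxt Hdt]]]; apply N.
apply Rle_trans with (/ delta t).
- apply (Hdelta t St).
  replace (RtoC x + w - RtoC t)%C with (w + RtoC (x - t))%C
    by (rewrite RtoC_minus; ring).
  apply Rle_lt_trans with (1 := Cmod_triangle _ _); rewrite Cmod_R.
  pose proof (Rmin_l d mu); lra.
- apply Rinv_le_contravar; [apply cond_pos|exact Hdt].
Qed.

Lemma continuous_Cmod (g : R -> C) (t : R) :
  ccontinuous g t -> continuous (fun s => Cmod (g s)) t.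
Proof.
intros Hg; apply continuity_pt_filterlim; intros eps He.
destruct (proj1 (ccontinuous_iff _ _) Hg eps He) as [d [Hd H]].
exists d; split; [exact Hd|]; intros s [_ Hs]; simpl in *.
unfold Rdist in *.
specialize (H s Hs).
pose proof (Cmod_minus_ge (g s) (g t)) as T1.
pose proof (Cmod_minus_ge (g t) (g s)) as T2; rewrite Cmod_opp_minus in T2.
apply Rabs_def1; lra.
Qed.

Lemma continuous_Cmod_real (f : C -> C) (t : R) :
  cdiff f (RtoC t) -> continuous (fun s => Cmod (f (RtoC s))) t.
Proof. intros H; apply continuous_Cmod; apply (ccontinuous_hor f 0 t), H. Qed.

Lemma primitive_increment_le (G g : C -> C) (m : R -> R) (d x : R) :
  (forall t, seg t -> is_cderive G (RtoC t) (g (RtoC t))) ->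
  (forall t, seg t -> ccontinuous (fun s => g (RtoC s)) t) ->
  (forall t, seg t -> continuous m t) ->
  (forall t, seg t -> Cmod (g (RtoC t)) <= m t) ->
  seg d -> seg x ->
  Cmod (G (RtoC x) - G (RtoC d)) <= RInt m (-1) 1.
Proof.
intros HG Hg Hm Hgm.
assert (W : forall d x, seg d -> seg x -> d <= x ->
   Cmod (G (RtoC x) - G (RtoC d)) <= RInt m (-1) 1).
{ clear d x; intros d x Sd Sx Hdx; unfold seg in *.
  assert (Ex : forall u v, -1 <= u -> u <= v -> v <= 1 -> ex_RInt m u v).
  { intros u v Hu Huv Hv; apply (ex_RInt_continuous (V := R_CompleteNormedModule)).
    rewrite Rmin_left, Rmax_right by lra; intros t Ht; apply Hm; lra. }
  assert (Pos : forall u v, -1 <= u -> u <= v -> v <= 1 -> 0 <= RInt m u v).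
  { intros u v Hu Huv Hv; apply RInt_ge_0; [lra|auto|].
    intros t Ht; apply Rle_trans with (1 := Cmod_ge_0 (g (RtoC t))), Hgm; lra. }
  rewrite <- (RInt_Chasles m (-1) d 1), <- (RInt_Chasles m d x 1) by (apply Ex; lra).
  unfold plus; simpl.
  pose proof (Pos (-1) d ltac:(lra) ltac:(lra) ltac:(lra)).
  pose proof (Pos x 1 ltac:(lra) ltac:(lra) ltac:(lra)).
  enough (Cmod (G (RtoC x) - G (RtoC d)) <= RInt m d x) by lra.
  rewrite Cmod_norm.
  apply (norm_RInt_le (V := C_R_NormedModule) (fun t => g (RtoC t) * RtoC 1)%C m d x);
    [exact Hdx| | |].
  - intros t Ht; rewrite <- Cmod_norm, Cmult_1_r; apply Hgm; lra.
  - apply (is_CInt_comp_derive G g RtoC (fun _ => RtoC 1));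
      rewrite Rmin_left, Rmax_right by lra; intros t Ht.
    + apply HG; lra.
    + apply is_rderive_hor.
    + apply Hg; lra.
    + apply ccontinuous_const.
  - apply (RInt_correct (V := R_CompleteNormedModule)), Ex; lra. }
intros Sd Sx; destruct (Rle_dec d x); [now apply W|].
rewrite Cmod_opp_minus; apply W; auto; lra.
Qed.

(** From d to z = x + w with |w| < r, the path along the real axis to x
    contributes an integral over [-1, 1], and the segment from x to z at most r K.
    The first term does not shrink with r; this is why L^1 norms appear in the
    existence condition. *)
Lemma primitive_increment_nbhd_le (G g : C -> C) (m : R -> R) (r K d : R) (z : C) :
  (forall z, seg_nbhd r z -> is_cderive G z (g z) /\ cdiff g z /\ Cmod (g z) <= K) ->
  (forall t, seg t -> continuous m t) ->
  (forall t, seg t -> Cmod (g (RtoC t)) <= m t) ->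
  seg d -> seg_nbhd r z ->
  Cmod (G z - G (RtoC d)) <= RInt m (-1) 1 + r * K.
Proof.
intros H Hm Hgm Sd Uz; pose proof (seg_nbhd_pos r z Uz) as Hr.
destruct Uz as [x [w [Sx [Hw ->]]]].
replace (G (RtoC x + w)%C - G (RtoC d))%C with
  ((G (RtoC x) - G (RtoC d)) + (G (RtoC x + w)%C - G (RtoC x)))%C by ring.
apply Rle_trans with (1 := Cmod_triangle _ _).
apply Rplus_le_compat.
- apply primitive_increment_le with g; auto; intros t St.
  + apply H, seg_nbhd_RtoC; auto.
  + apply (ccontinuous_hor g 0 t), H, (seg_nbhd_RtoC r t Hr St).
- assert (HK : 0 <= K).
  { apply Rle_trans with (1 := Cmod_ge_0 (g (RtoC x))), H, seg_nbhd_RtoC; auto. }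
  apply Rle_trans with (K * Cmod (RtoC x + w - RtoC x)).
  + apply Cmod_mean_value; intros t Ht.
    replace (RtoC x + w - RtoC x)%C with w by ring.
    exists (g (RtoC x + RtoC t * w)%C).
    enough (U : seg_nbhd r (RtoC x + RtoC t * w)%C)
      by (split; apply H, U).
    exists x, (RtoC t * w)%C; split; [exact Sx|]; split; [|reflexivity].
    rewrite Cmod_mult, Cmod_R, Rabs_pos_eq by lra.
    pose proof (Cmod_ge_0 w); nra.
  + replace (RtoC x + w - RtoC x)%C with w by ring; nra.
Qed.

(** * The polynomial and its majorant *)

Definition poly_under_deriv (coef : nat -> R) (n : nat) (x : R) : R :=
  sum_n_m (fun j => Rabs (coef j) * (INR j * x ^ pred j)) 1 n.

Lemma poly_under_S (coef : nat -> R) (n : nat) (x : R) :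
  poly_under coef (S n) x = poly_under coef n x + Rabs (coef (S n)) * x ^ S n.
Proof. unfold poly_under; rewrite sum_n_Sm by lia; reflexivity. Qed.

Lemma poly_under_deriv_S (coef : nat -> R) (n : nat) (x : R) :
  poly_under_deriv coef (S n) x =
  poly_under_deriv coef n x + Rabs (coef (S n)) * (INR (S n) * x ^ n).
Proof. unfold poly_under_deriv; rewrite sum_n_Sm by lia; reflexivity. Qed.

Lemma poly_eval_S (coef : nat -> R) (n : nat) (z : C) :
  poly_eval coef (S n) z = (poly_eval coef n z + RtoC (coef (S n)) * Cpow z (S n))%C.
Proof. unfold poly_eval; rewrite sum_Sn; reflexivity. Qed.

Lemma poly_under_0 (coef : nat -> R) (x : R) : poly_under coef 0 x = 0.
Proof. unfold poly_under; now rewrite sum_n_m_zero by lia. Qed.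

Lemma poly_under_deriv_0 (coef : nat -> R) (x : R) : poly_under_deriv coef 0 x = 0.
Proof. unfold poly_under_deriv; now rewrite sum_n_m_zero by lia. Qed.

Lemma is_derive_poly_under (coef : nat -> R) (n : nat) (x : R) :
  is_derive (poly_under coef n) x (poly_under_deriv coef n x).
Proof.
induction n as [|n IH].
- rewrite poly_under_deriv_0.
  apply is_derive_ext with (fun _ => 0); [intros; now rewrite poly_under_0|].
  apply (is_derive_const (K := R_AbsRing) (V := R_NormedModule)).
- rewrite poly_under_deriv_S.
  apply is_derive_ext with
    (fun x => poly_under coef n x + Rabs (coef (S n)) * x ^ S n);
    [intros; now rewrite poly_under_S|].
  apply (is_derive_plus (V := R_NormedModule)); [exact IH|].
  apply is_derive_scal.
  replace (INR (S n) * x ^ n) with (INR (S n) * 1 * x ^ pred (S n))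
    by (simpl pred; ring).
  apply is_derive_pow, (is_derive_id (K := R_AbsRing)).
Qed.

Lemma poly_under_deriv_le (coef : nat -> R) (n : nat) (x y : R) :
  0 <= x <= y -> 0 <= poly_under_deriv coef n x <= poly_under_deriv coef n y.
Proof.
intros H; induction n as [|n IH]; [rewrite !poly_under_deriv_0; lra|].
rewrite !poly_under_deriv_S.
assert (0 <= x ^ n) by (apply pow_le; lra).
assert (x ^ n <= y ^ n) by (apply pow_incr; lra).
pose proof (Rabs_pos (coef (S n))); pose proof (pos_INR (S n)).
assert (0 <= INR (S n) * x ^ n) by (apply Rmult_le_pos; lra).
assert (INR (S n) * x ^ n <= INR (S n) * y ^ n)
  by (apply Rmult_le_compat_l; lra).
nra.
Qed.

Lemma poly_under_deriv_lt (coef : nat -> R) (n : nat) (x y : R) :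
  (2 <= n)%nat -> coef n <> 0 -> 0 <= x < y ->
  poly_under_deriv coef n x < poly_under_deriv coef n y.
Proof.
intros Hn Hc H; destruct n as [|n]; [lia|].
rewrite !poly_under_deriv_S.
pose proof (poly_under_deriv_le coef n x y ltac:(lra)).
assert (0 < INR (S n)) by (apply lt_0_INR; lia).
pose proof (Rabs_pos_lt _ Hc).
assert (x ^ n < y ^ n).
{ destruct n as [|m]; [lia|]; simpl.
  assert (0 < y ^ m) by (apply pow_lt; lra).
  assert (x ^ m <= y ^ m) by (apply pow_incr; lra).
  assert (0 <= x ^ m) by (apply pow_le; lra); nra. }
assert (INR (S n) * x ^ n < INR (S n) * y ^ n) by (apply Rmult_lt_compat_l; lra).
nra.
Qed.

Lemma poly_under_nonneg (coef : nat -> R) (n : nat) (x : R) :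
  0 <= x -> 0 <= poly_under coef n x.
Proof.
intros H; induction n as [|n IH]; [rewrite poly_under_0; lra|].
rewrite poly_under_S.
pose proof (Rmult_le_pos _ _ (Rabs_pos (coef (S n))) (pow_le x (S n) H)); lra.
Qed.

Lemma Cpow_lipschitz (z w : C) (r : R) (n : nat) :
  Cmod z <= r -> Cmod w <= r ->
  Cmod (Cpow z (S n) - Cpow w (S n)) <= INR (S n) * r ^ n * Cmod (z - w).
Proof.
intros Hz Hw; assert (Hr : 0 <= r) by (pose proof (Cmod_ge_0 z); lra).
induction n as [|n IH].
- simpl; rewrite !Cmult_1_r; lra.
- replace (Cpow z (S (S n)) - Cpow w (S (S n)))%C with
    (z * (Cpow z (S n) - Cpow w (S n)) + (z - w) * Cpow w (S n))%C
    by (simpl; ring).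
  apply Rle_trans with (1 := Cmod_triangle _ _).
  rewrite !Cmod_mult, Cmod_pow.
  assert (T1 : Cmod w ^ S n <= r ^ S n)
    by (apply pow_incr; split; [apply Cmod_ge_0|exact Hw]).
  pose proof (Cmod_ge_0 (z - w)).
  assert (T2 : Cmod z * Cmod (Cpow z (S n) - Cpow w (S n))
            <= r * (INR (S n) * r ^ n * Cmod (z - w)))
    by (apply Rmult_le_compat; auto using Cmod_ge_0).
  rewrite (S_INR (S n)).
  replace ((INR (S n) + 1) * r ^ S n * Cmod (z - w)) with
   (r * (INR (S n) * r ^ n * Cmod (z - w)) + Cmod (z - w) * r ^ S n)
   by (simpl pow; ring).
  apply Rplus_le_compat; [exact T2|]; apply Rmult_le_compat_l; lra.
Qed.

Lemma poly_eval_lipschitz (coef : nat -> R) (n : nat) (z w : C) (r : R) :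
  Cmod z <= r -> Cmod w <= r ->
  Cmod (poly_eval coef n z - poly_eval coef n w)
    <= poly_under_deriv coef n r * Cmod (z - w).
Proof.
intros Hz Hw; induction n as [|n IH].
- unfold poly_eval; rewrite !sum_O; simpl.
  replace (RtoC (coef O) * RtoC 1 - RtoC (coef O) * RtoC 1)%C with (RtoC 0) by ring.
  rewrite Cmod_0, poly_under_deriv_0; lra.
- rewrite !poly_eval_S, poly_under_deriv_S.
  match goal with |- Cmod ?e <= _ => replace e with
   ((poly_eval coef n z - poly_eval coef n w)
     + RtoC (coef (S n)) * (Cpow z (S n) - Cpow w (S n)))%C by ring end.
  apply Rle_trans with (1 := Cmod_triangle _ _); rewrite Cmod_mult, Cmod_R.
  pose proof (Cpow_lipschitz z w r n Hz Hw).
  pose proof (Rabs_pos (coef (S n))); nra.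
Qed.

Lemma poly_eval_minus_0 (coef : nat -> R) (n : nat) (z : C) (r : R) :
  Cmod z <= r ->
  Cmod (poly_eval coef n z - poly_eval coef n (RtoC 0)) <= poly_under coef n r.
Proof.
intros Hz; induction n as [|n IH].
- unfold poly_eval; rewrite !sum_O; simpl.
  replace (RtoC (coef O) * RtoC 1 - RtoC (coef O) * RtoC 1)%C with (RtoC 0) by ring.
  rewrite Cmod_0, poly_under_0; lra.
- rewrite !poly_eval_S, poly_under_S.
  match goal with |- Cmod ?e <= _ => replace e with
   ((poly_eval coef n z - poly_eval coef n (RtoC 0))
     + RtoC (coef (S n)) * Cpow z (S n))%C by (simpl Cpow; ring) end.
  apply Rle_trans with (1 := Cmod_triangle _ _); rewrite Cmod_mult, Cmod_R, Cmod_pow.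
  assert (Cmod z ^ S n <= r ^ S n)
    by (apply pow_incr; split; [apply Cmod_ge_0|exact Hz]).
  pose proof (Rabs_pos (coef (S n))); nra.
Qed.

Lemma cdiff_Cpow (n : nat) (z : C) : cdiff (fun w => Cpow w n) z.
Proof.
induction n as [|n [l Hl]].
{ exists (RtoC 0); exact (is_cderive_const (RtoC 1) z). }
eexists; exact (is_cderive_mult (fun w => w) (fun w => Cpow w n) z _ l (is_cderive_id z) Hl).
Qed.

Lemma cdiff_poly_eval (coef : nat -> R) (n : nat) (z : C) :
  cdiff (poly_eval coef n) z.
Proof.
induction n as [|n [l Hl]].
- apply (ex_derive_ext (K := C_AbsRing) (V := C_NormedModule)
    (fun _ => RtoC (coef O) * RtoC 1)%C).
  + intros w; unfold poly_eval; now rewrite sum_O.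
  + eexists; apply is_cderive_const.
- apply (ex_derive_ext (K := C_AbsRing) (V := C_NormedModule)
    (fun w => poly_eval coef n w + RtoC (coef (S n)) * Cpow w (S n))%C).
  + intros w; now rewrite poly_eval_S.
  + destruct (cdiff_Cpow (S n) z) as [m Hm].
    eexists; apply is_cderive_plus; [exact Hl|].
    apply (is_cderive_mult (fun _ => RtoC (coef (S n)))); [apply is_cderive_const|].
    exact Hm.
Qed.

(** * Picard iteration on shrinking neighbourhoods *)

Lemma ex_RInt_Cmod (f : C -> C) :
  (forall t, seg t -> cdiff f (RtoC t)) ->
  ex_RInt (fun t => Cmod (f (RtoC t))) (-1) 1.
Proof.
intros H; apply (ex_RInt_continuous (V := R_CompleteNormedModule)).
rewrite Rmin_left, Rmax_right by lra; intros t Ht.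
apply continuous_Cmod_real, H, Ht.
Qed.

Lemma norm1_nonneg (f : C -> C) :
  (forall t, seg t -> cdiff f (RtoC t)) -> 0 <= norm1 f.
Proof.
intros H; apply RInt_ge_0; [lra|now apply ex_RInt_Cmod|]; intros; apply Cmod_ge_0.
Qed.

Lemma RInt_Cmod_scal (f : C -> C) (l : R) :
  (forall t, seg t -> cdiff f (RtoC t)) ->
  RInt (fun t => l * Cmod (f (RtoC t))) (-1) 1 = norm1 f * l.
Proof.
intros H; rewrite Rmult_comm.
apply (RInt_scal (V := R_CompleteNormedModule)); now apply ex_RInt_Cmod.
Qed.

Lemma RInt_Cmod_plus_scal (f g : C -> C) (l : R) :
  (forall t, seg t -> cdiff f (RtoC t)) ->
  (forall t, seg t -> cdiff g (RtoC t)) ->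
  RInt (fun t => Cmod (f (RtoC t)) + l * Cmod (g (RtoC t))) (-1) 1
    = norm1 f + norm1 g * l.
Proof.
intros Hf Hg; rewrite <- RInt_Cmod_scal by assumption.
apply (RInt_plus (V := R_CompleteNormedModule)); [now apply ex_RInt_Cmod|].
apply (ex_RInt_scal (V := R_NormedModule)); now apply ex_RInt_Cmod.
Qed.

(** Since alpha P_'(theta) = 1, the upper bound on beta reads
    beta + alpha P_(theta) < theta.  This strict inequality persists slightly to
    the left of theta, where in addition alpha P_' is less than 1 because P_' is
    strictly increasing. *)
Lemma choose_radius (alpha beta theta : R) (coef : nat -> R) (N0 : nat) :
  (2 <= N0)%nat -> coef N0 <> 0 -> 0 <= alpha -> 0 < theta ->
  alpha * Derive (poly_under coef N0) theta = 1 ->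
  beta < theta - poly_under coef N0 theta / Derive (poly_under coef N0) theta ->
  exists r, 0 < r /\ beta + alpha * poly_under coef N0 r < r /\
    alpha * poly_under_deriv coef N0 r < 1.
Proof.
intros HN Hc Ha Ht H1 Hb.
rewrite (is_derive_unique _ _ _ (is_derive_poly_under coef N0 theta)) in H1, Hb.
assert (Ha' : 0 < alpha) by (destruct Ha as [Ha| <-]; [exact Ha|lra]).
assert (Hq : poly_under_deriv coef N0 theta <> 0) by (intros E; rewrite E in H1; lra).
replace (poly_under coef N0 theta / poly_under_deriv coef N0 theta)
  with (alpha * poly_under coef N0 theta) in Hb.
2:{ apply Rmult_eq_reg_r with (poly_under_deriv coef N0 theta); [|exact Hq].
    transitivity (alpha * poly_under_deriv coef N0 theta * poly_under coef N0 theta);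
      [ring|rewrite H1; field; exact Hq]. }
set (gap := theta - alpha * poly_under coef N0 theta - beta).
assert (Hcont : continuity_pt (fun x => x - alpha * poly_under coef N0 x) theta).
{ apply derivable_continuous_pt.
  exists (1 - alpha * poly_under_deriv coef N0 theta).
  apply is_derive_Reals.
  apply (is_derive_minus (V := R_NormedModule)).
  - apply (is_derive_id (K := R_AbsRing)).
  - apply is_derive_scal, is_derive_poly_under. }
destruct (Hcont gap) as [e [He H]]; [unfold gap; lra|].
set (s := Rmin e theta).
assert (Hs : 0 < s) by (apply Rmin_pos; lra).
assert (s <= e) by apply Rmin_l; assert (s <= theta) by apply Rmin_r.
exists (theta - s / 2); split; [lra|]; split.
- specialize (H (theta - s / 2)).
  assert (K : Rabs (theta - s / 2 - alpha * poly_under coef N0 (theta - s / 2)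
     - (theta - alpha * poly_under coef N0 theta)) < gap).
  { apply H; split.
    - split; [exact I|lra].
    - simpl; unfold Rdist.
      replace (theta - s / 2 - theta) with (- (s / 2)) by ring.
      rewrite Rabs_Ropp, Rabs_pos_eq; lra. }
  apply Rabs_def2 in K; unfold gap in K; lra.
- rewrite <- H1; apply Rmult_lt_compat_l; [exact Ha'|].
  apply poly_under_deriv_lt; auto; lra.
Qed.

(** The invariance of the disc of radius r comes from
    a P(v) + b = g0 + a (P(v) - P(0)), with |P(v) - P(0)| <= P_(r) for |v| <= r.
    The geometric decay comes from the Lipschitz constant P_'(r) of P on the same
    disc.  Both use [primitive_increment_nbhd_le]. *)
Theorem picard_sequence (a b psi : C -> C) (coef : nat -> R) (N0 : nat)
  (d c A Ka Kg r q : R) (rho : nat -> R) :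
  let P := poly_eval coef N0 in
  let g0 := fun z : C => Cplus (b z) (Cmult (P (RtoC 0)) (a z)) in
  seg d ->
  (forall n, 0 < rho n <= A) -> (forall n, rho (S n) <= rho n) ->
  (forall z, seg_nbhd A z -> cdiff a z /\ cdiff b z /\ cdiff psi z) ->
  (forall n z, seg_nbhd (rho (S n)) z -> seg_nbhd (rho n) (psi z)) ->
  (forall z, seg_nbhd A z -> Cmod (a z) <= Ka /\ Cmod (g0 z) <= Kg) ->
  0 < r -> 0 <= q ->
  norm1 g0 + Rabs c + norm1 a * poly_under coef N0 r
    + A * (Kg + Ka * poly_under coef N0 r) <= r ->
  (norm1 a + A * Ka) * poly_under_deriv coef N0 r <= q ->
  exists f : nat -> C -> C,
    (forall n z, seg_nbhd (rho n) z -> cdiff (f n) z /\ Cmod (f n z) <= r) /\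
    (forall n z, seg_nbhd (rho (S n)) z ->
       is_cderive (f (S n)) z (a z * P (f n (psi z)) + b z)%C) /\
    (forall n z, seg_nbhd (rho (S n)) z ->
       Cmod (f (S n) z - f n z) <= 2 * r * q ^ n) /\
    (forall n, f n (RtoC d) = RtoC c).
Proof.
intros P g0 Sd Hrho Hdec Hdiff Hpsi Hbd Hr Hq Hself Hcontr.
set (Q := poly_under coef N0) in *; set (Q' := poly_under_deriv coef N0) in *.
assert (HQ : 0 <= Q r) by (apply poly_under_nonneg; lra).
assert (HQ' : 0 <= Q' r) by (apply (poly_under_deriv_le coef N0 r r); lra).
assert (HA : 0 < A) by (specialize (Hrho O); lra).
assert (UA : forall n z, seg_nbhd (rho n) z -> seg_nbhd A z)
  by (intros n z; apply seg_nbhd_le, Hrho).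
assert (SA : forall t, seg t -> seg_nbhd A (RtoC t))
  by (intros; now apply seg_nbhd_RtoC).
assert (Hg0 : forall z, seg_nbhd A z -> cdiff g0 z).
{ intros z Uz; destruct (Hdiff z Uz) as [[la Hla] [[lb Hlb] _]].
  eexists; apply is_cderive_plus; [exact Hlb|].
  apply (is_cderive_mult (fun _ => P (RtoC 0))); [apply is_cderive_const|exact Hla]. }
assert (Hga : forall t, seg t -> cdiff g0 (RtoC t)) by auto.
assert (Haa : forall t, seg t -> cdiff a (RtoC t)) by (intros; apply Hdiff; auto).
assert (HKa : 0 <= Ka).
{ apply Rle_trans with (1 := Cmod_ge_0 (a (RtoC d))), Hbd; auto. }
assert (HKg : 0 <= Kg).
{ apply Rle_trans with (1 := Cmod_ge_0 (g0 (RtoC d))), Hbd; auto. }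
pose proof (norm1_nonneg g0 Hga) as Hn0; pose proof (norm1_nonneg a Haa) as Hna.
assert (Hsmall : forall n B, 0 <= B -> rho n * B <= A * B).
{ intros n B HB; apply Rmult_le_compat_r; [exact HB|apply Hrho]. }
set (rhs := fun (f : C -> C) z => (a z * P (f (psi z)) + b z)%C).
assert (Hcomp : forall n f, (forall z, seg_nbhd (rho n) z -> cdiff f z) ->
  forall z, seg_nbhd (rho (S n)) z -> cdiff (fun w => P (f (psi w))) z).
{ intros n f Hf z Uz; destruct (Hdiff z (UA _ _ Uz)) as [_ [_ [lp Hlp]]].
  destruct (Hf _ (Hpsi n z Uz)) as [lf Hlf].
  destruct (cdiff_poly_eval coef N0 (f (psi z))) as [l Hl].
  eexists; apply (is_cderive_comp P (fun w => f (psi w))); [exact Hl|].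
  apply is_cderive_comp; eassumption. }
assert (Hrhs : forall n f, (forall z, seg_nbhd (rho n) z -> cdiff f z) ->
  forall z, seg_nbhd (rho (S n)) z -> cdiff (rhs f) z).
{ intros n f Hf z Uz; destruct (Hdiff z (UA _ _ Uz)) as [[la Hla] [[lb Hlb] _]].
  destruct (Hcomp n f Hf z Uz) as [l Hl].
  eexists; apply is_cderive_plus; [|exact Hlb].
  apply (is_cderive_mult a (fun w => P (f (psi w)))); eassumption. }
assert (step : forall n f, exists f' : C -> C,
  (forall z, seg_nbhd (rho n) z -> cdiff f z) ->
  (forall z, seg_nbhd (rho (S n)) z -> is_cderive f' z (rhs f z)) /\
  f' (RtoC d) = RtoC c).
{ intros n f; destruct (classic (forall z, seg_nbhd (rho n) z -> cdiff f z))
    as [Hf|Hf]; [|exists f; contradiction].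
  destruct (seg_nbhd_primitive (rho (S n)) (rhs f) (Hrhs n f Hf)) as [G HG].
  exists (fun z => G z + (RtoC c - G (RtoC d)))%C; intros _; split.
  - intros z Uz; replace (rhs f z) with (rhs f z + RtoC 0)%C by ring.
    apply is_cderive_plus; [now apply HG|apply is_cderive_const].
  - ring. }
set (next := fun n f => proj1_sig (constructive_indefinite_description _ (step n f))).
assert (Hnext : forall n f, (forall z, seg_nbhd (rho n) z -> cdiff f z) ->
  (forall z, seg_nbhd (rho (S n)) z -> is_cderive (next n f) z (rhs f z)) /\
  next n f (RtoC d) = RtoC c).
{ intros n f; exact (proj2_sig (constructive_indefinite_description _ (step n f))). }
clearbody next; clear step.
set (f := fix f n := match n with
                     | O => fun _ : C => RtoC c
                     | S m => next m (f m)
                     end).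
assert (Hf : forall n z, seg_nbhd (rho n) z -> cdiff (f n) z).
{ induction n as [|n IH]; intros z Uz.
  - exists (RtoC 0); apply is_cderive_const.
  - eexists; exact (proj1 (Hnext n (f n) IH) z Uz). }
assert (Hf' : forall n z, seg_nbhd (rho (S n)) z ->
   is_cderive (f (S n)) z (rhs (f n) z)).
{ intros n; exact (proj1 (Hnext n (f n) (Hf n))). }
assert (Hfd : forall n, f n (RtoC d) = RtoC c).
{ intros [|n]; [reflexivity|exact (proj2 (Hnext n (f n) (Hf n)))]. }
assert (Hfr : forall n z, seg_nbhd (rho n) z -> Cmod (f n z) <= r).
{ induction n as [|n IH]; intros z Uz.
  - change (f O z) with (RtoC c); rewrite Cmod_R.
    pose proof (Rmult_le_pos _ _ Hna HQ).
    assert (0 <= A * (Kg + Ka * Q r)).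
    { apply Rmult_le_pos; [lra|]; pose proof (Rmult_le_pos _ _ HKa HQ); lra. }
    lra.
  - assert (Hsplit : forall w, seg_nbhd (rho (S n)) w ->
      Cmod (rhs (f n) w) <= Cmod (g0 w) + Q r * Cmod (a w)).
    { intros w Uw; unfold rhs.
      replace (a w * P (f n (psi w)) + b w)%C with
        (g0 w + a w * (P (f n (psi w)) - P (RtoC 0)))%C by (unfold g0; ring).
      apply Rle_trans with (1 := Cmod_triangle _ _); rewrite Cmod_mult.
      pose proof (poly_eval_minus_0 coef N0 (f n (psi w)) r (IH _ (Hpsi n w Uw))) as E.
      pose proof (Cmod_ge_0 (a w)); unfold P, Q; nra. }
    pose proof (primitive_increment_nbhd_le (f (S n)) (rhs (f n))
      (fun t => Cmod (g0 (RtoC t)) + Q r * Cmod (a (RtoC t)))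
      (rho (S n)) (Kg + Ka * Q r) d z) as E.
    rewrite RInt_Cmod_plus_scal, Hfd in E by auto.
    assert (E' : Cmod (f (S n) z - RtoC c) <=
      norm1 g0 + norm1 a * Q r + rho (S n) * (Kg + Ka * Q r)).
    { apply E; auto.
      - intros w Uw; split; [now apply Hf'|]; split; [apply (Hrhs n (f n) (Hf n) w Uw)|].
        apply Rle_trans with (1 := Hsplit w Uw).
        destruct (Hbd w (UA _ _ Uw)) as [B1 B2]; nra.
      - intros t St; apply (continuous_plus (V := R_NormedModule)).
        + apply continuous_Cmod_real; auto.
        + apply (continuous_scal_r (V := R_NormedModule)), continuous_Cmod_real; auto.
      - intros t St; apply Hsplit, seg_nbhd_RtoC; [apply Hrho|exact St]. }
    pose proof (Cmod_minus_ge (f (S n) z) (RtoC c)) as T; rewrite Cmod_R in T.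
    assert (0 <= Kg + Ka * Q r) by (pose proof (Rmult_le_pos _ _ HKa HQ); lra).
    specialize (Hsmall (S n) (Kg + Ka * Q r) ltac:(assumption)); lra. }
exists f; split; [auto|]; split; [exact Hf'|]; split; [|exact Hfd].
induction n as [|n IH]; intros z Uz.
- simpl pow; rewrite Rmult_1_r.
  replace (f 1%nat z - f 0%nat z)%C with (f 1%nat z + - f 0%nat z)%C by ring.
  apply Rle_trans with (1 := Cmod_triangle _ _); rewrite Cmod_opp.
  pose proof (Hfr 1%nat z Uz); pose proof (Hfr 0%nat z (seg_nbhd_le _ _ _ (Hdec 0%nat) Uz)).
  lra.
- set (e := 2 * r * q ^ n) in *.
  assert (He : 0 <= e) by (apply Rmult_le_pos; [lra|now apply pow_le]).
  assert (Hle : forall w, seg_nbhd (rho (S (S n))) w -> seg_nbhd (rho (S n)) w)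
    by (intros w; apply seg_nbhd_le, Hdec).
  set (g := fun w => (a w * (P (f (S n) (psi w)) - P (f n (psi w))))%C).
  assert (Hg : forall w, seg_nbhd (rho (S (S n))) w ->
     Cmod (g w) <= Q' r * e * Cmod (a w)).
  { intros w Uw; unfold g; rewrite Cmod_mult, Rmult_comm.
    apply Rmult_le_compat_r; [apply Cmod_ge_0|].
    pose proof (Hpsi (S n) w Uw) as Up.
    apply Rle_trans with (Q' r * Cmod (f (S n) (psi w) - f n (psi w))).
    - apply poly_eval_lipschitz; apply Hfr; [exact Up|].
      apply seg_nbhd_le with (2 := Up), Hdec.
    - apply Rmult_le_compat_l; [exact HQ'|]; apply IH, Up. }
  pose proof (primitive_increment_nbhd_le (fun w => f (S (S n)) w - f (S n) w)%C g
    (fun t => Q' r * e * Cmod (a (RtoC t))) (rho (S (S n))) (Ka * (Q' r * e)) d z) as E.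
  rewrite RInt_Cmod_scal, !Hfd in E by auto.
  assert (E' : Cmod (f (S (S n)) z - f (S n) z - (RtoC c - RtoC c)) <=
     norm1 a * (Q' r * e) + rho (S (S n)) * (Ka * (Q' r * e))).
  { apply E; auto.
    - intros w Uw; split; [|split].
      + replace (g w) with (rhs (f (S n)) w - rhs (f n) w)%C by (unfold g, rhs; ring).
        apply is_cderive_minus; [now apply Hf'|apply Hf'; auto].
      + destruct (Hdiff w (UA _ _ Uw)) as [[la Hla] _].
        destruct (Hcomp (S n) (f (S n)) (Hf (S n)) w Uw) as [l1 Hl1].
        destruct (Hcomp n (f n) (Hf n) w (Hle w Uw)) as [l2 Hl2].
        eexists; apply (is_cderive_mult a); [exact Hla|].
        apply is_cderive_minus; eassumption.
      + apply Rle_trans with (1 := Hg w Uw).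
        rewrite Rmult_comm; apply Rmult_le_compat_r.
        * now apply Rmult_le_pos.
        * apply Hbd, (UA _ _ Uw).
    - intros t St; apply (continuous_scal_r (V := R_NormedModule)), continuous_Cmod_real.
      auto.
    - intros t St; apply Hg, seg_nbhd_RtoC; [apply Hrho|exact St]. }
  replace (f (S (S n)) z - f (S n) z - (RtoC c - RtoC c))%C
    with (f (S (S n)) z - f (S n) z)%C in E' by ring.
  apply Rle_trans with (1 := E').
  assert (0 <= Ka * (Q' r * e)) by (apply Rmult_le_pos; [|apply Rmult_le_pos]; assumption).
  specialize (Hsmall (S (S n)) (Ka * (Q' r * e)) ltac:(assumption)).
  replace (2 * r * q ^ S n) with (q * e) by (unfold e; simpl; ring).
  apply Rle_trans with ((norm1 a + A * Ka) * Q' r * e); [lra|].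
  now apply Rmult_le_compat_r.
Qed.

(** * Termwise differentiation and Gevrey bounds *)

Definition Csum (u : nat -> C) : C :=
  (Series (fun n => fst (u n)), Series (fun n => snd (u n))).

Lemma Series_dominated (v : nat -> R) (K s : R) :
  0 <= s < 1 -> (forall n, Rabs (v n) <= K * s ^ n) ->
  ex_series v /\ Rabs (Series v) <= K / (1 - s).
Proof.
intros Hs Hv.
assert (G : is_series (fun n => K * s ^ n) (K / (1 - s))).
{ apply (is_series_scal (K := R_AbsRing) (V := R_NormedModule) K),
    is_series_geom; rewrite Rabs_pos_eq; lra. }
assert (E : ex_series (fun n => Rabs (v n))).
{ apply (ex_series_le (V := R_CompleteNormedModule) _ (fun n => K * s ^ n)).
  - intros n; unfold norm; simpl; unfold abs; simpl; rewrite Rabs_Rabsolu; auto.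
  - eexists; exact G. }
split; [now apply ex_series_Rabs|].
apply Rle_trans with (1 := Series_Rabs v E).
rewrite <- (is_series_unique _ _ G).
apply Series_le; [|eexists; exact G].
intros n; split; [apply Rabs_pos|apply Hv].
Qed.

Definition dominated (u : nat -> C) (K s : R) : Prop :=
  forall n, Cmod (u n) <= K * s ^ n.

Lemma Csum_dominated (u : nat -> C) (K s : R) :
  0 <= s < 1 -> dominated u K s ->
  ex_series (fun n => fst (u n)) /\ ex_series (fun n => snd (u n)) /\
  Cmod (Csum u) <= 2 * K / (1 - s).
Proof.
intros Hs Hu.
destruct (Series_dominated (fun n => fst (u n)) K s Hs) as [E1 B1].
{ intros n; apply Rle_trans with (2 := Hu n), (re_le_Cmod (u n)). }
destruct (Series_dominated (fun n => snd (u n)) K s Hs) as [E2 B2].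
{ intros n; apply Rle_trans with (2 := Hu n), (im_le_Cmod (u n)). }
split; [exact E1|]; split; [exact E2|].
apply Rle_trans with (1 := Cmod_pair _ _); unfold Rdiv in *; lra.
Qed.

Lemma Csum_taylor (u v w : nat -> C) (h s Ku Kv Kw : R) :
  0 <= s < 1 -> dominated u Ku s -> dominated v Kv s -> dominated w Kw s ->
  Csum (fun n => u n - v n - RtoC h * w n)%C
    = (Csum u - Csum v - RtoC h * Csum w)%C.
Proof.
intros Hs Hu Hv Hw.
destruct (Csum_dominated u Ku s Hs Hu) as [U1 [U2 _]].
destruct (Csum_dominated v Kv s Hs Hv) as [V1 [V2 _]].
destruct (Csum_dominated w Kw s Hs Hw) as [W1 [W2 _]].
apply injective_projections; simpl.
- rewrite (Series_ext _ (fun n => fst (u n) - fst (v n) - h * fst (w n)))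
    by (intros; simpl; ring).
  rewrite !Series_minus, Series_scal_l; try assumption; try ring.
  + now apply (ex_series_minus (V := R_NormedModule)).
  + now apply (ex_series_scal (V := R_NormedModule)).
- rewrite (Series_ext _ (fun n => snd (u n) - snd (v n) - h * snd (w n)))
    by (intros; simpl; ring).
  rewrite !Series_minus, Series_scal_l; try assumption; try ring.
  + now apply (ex_series_minus (V := R_NormedModule)).
  + now apply (ex_series_scal (V := R_NormedModule)).
Qed.

Lemma Csum_tail (u part : nat -> C) (K s : R) :
  0 <= s < 1 -> dominated u K s -> part O = u O ->
  (forall n, u (S n) = part (S n) - part n)%C ->
  forall n, Cmod (Csum u - part n) <= 2 * K / (1 - s) * s ^ n.
Proof.
intros Hs Hu H0 Hpart n.
assert (HK : 0 <= K).
{ pose proof (Hu O) as E; simpl in E; pose proof (Cmod_ge_0 (u O)); lra. }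
assert (Hshift : forall m, dominated (fun i => u (m + i)%nat) (K * s ^ m) s).
{ intros m i; rewrite Rmult_assoc, <- pow_add; apply Hu. }
assert (Hstep : forall m, Csum (fun i => u (m + i)%nat) =
   (u m + Csum (fun i => u (S m + i)%nat))%C).
{ intros m; destruct (Csum_dominated _ _ _ Hs (Hshift m)) as [E1 [E2 _]].
  apply injective_projections; simpl.
  - rewrite Series_incr_1 by exact E1; rewrite Nat.add_0_r; f_equal.
    apply Series_ext; intros i; now rewrite Nat.add_succ_r.
  - rewrite Series_incr_1 by exact E2; rewrite Nat.add_0_r; f_equal.
    apply Series_ext; intros i; now rewrite Nat.add_succ_r. }
assert (E : (Csum u - part n)%C = Csum (fun i => u (S n + i)%nat)).
{ induction n as [|n IH].
  - assert (E : Csum u = (u O + Csum (fun i => u (1 + i)%nat))%C)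
      by exact (Hstep O).
    rewrite E, H0; ring.
  - replace (Csum u - part (S n))%C
      with ((Csum u - part n) - (part (S n) - part n))%C by ring.
    rewrite IH, <- Hpart, (Hstep (S n)); ring. }
rewrite E.
destruct (Csum_dominated _ _ _ Hs (Hshift (S n))) as [_ [_ B]].
apply Rle_trans with (1 := B).
assert (0 < / (1 - s)) by (apply Rinv_0_lt_compat; lra).
assert (0 <= s ^ n) by (apply pow_le; lra).
replace (2 * (K * s ^ S n) / (1 - s)) with
  ((2 * K / (1 - s) * s ^ n) * s) by (unfold Rdiv; simpl; ring).
assert (0 <= 2 * K / (1 - s) * s ^ n).
{ apply Rmult_le_pos; [|assumption]; unfold Rdiv; apply Rmult_le_pos; lra. }
nra.
Qed.

Lemma le_0_of_geometric (x K s : R) :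
  0 <= s < 1 -> (forall n, x <= K * s ^ n) -> x <= 0.
Proof.
intros Hs H; apply Rnot_lt_le; intros Hx.
assert (HK : 0 < K) by (specialize (H O); simpl in H; lra).
destruct (pow_lt_1_zero s ltac:(rewrite Rabs_pos_eq; lra) (x / K)
  ltac:(apply Rdiv_lt_0_compat; lra)) as [n Hn].
specialize (Hn n (le_n n)); rewrite Rabs_pos_eq in Hn by (apply pow_le; lra).
specialize (H n).
apply Rmult_lt_compat_l with (r := K) in Hn; [|exact HK].
replace (K * (x / K)) with x in Hn by (field; lra); lra.
Qed.

Lemma ln_le_id (x : R) : 0 < x -> ln x <= x.
Proof.
intros Hx; rewrite <- (ln_exp x) at 2; left; apply ln_increasing; [exact Hx|].
apply Rlt_trans with (1 + x); [lra|]; apply exp_ineq1; lra.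
Qed.

Lemma exp_monotone (x y : R) : x <= y -> exp x <= exp y.
Proof. intros [H| ->]; [left; now apply exp_increasing|lra]. Qed.

Lemma pow_exp (x : R) (n : nat) : exp x ^ n = exp (INR n * x).
Proof.
induction n as [|n IH]; [simpl; now rewrite Rmult_0_l, exp_0|].
rewrite S_INR; simpl pow; rewrite IH, <- exp_plus; f_equal; ring.
Qed.

Definition gevrey_base (k A lam : R) : R :=
  2 / A * Rpower (/ (k * lam)) (1 / k).

(** With q = exp (-2 lam) and N = p0 + n, the left-hand side is
    q^n (2 m N^(1/k) / A)^m.  One factor exp (-lam n) is kept for the summation over
    n.  The other one pays for N^(m/k): since ln x <= x, the product
    N^(m/k) exp (-lam N) is at most (m / (k lam))^(m/k). *)
Lemma gevrey_term_bound (k A lam : R) (p0 n m : nat) :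
  0 < k -> 0 < A -> 0 < lam -> (1 <= p0)%nat ->
  exp (- 2 * lam) ^ n *
    (INR m / (A * Rpower (INR (p0 + n)) (- (1 / k)) / 2)) ^ m <=
  exp (2 * lam) ^ p0 * gevrey_base k A lam ^ m
    * Rpower (INR m) (INR m * (1 + 1 / k)) * exp (- lam) ^ n.
Proof.
intros Hk HA Hlam Hp0.
pose proof (pos_INR n) as Hn.
assert (HN : 1 <= INR (p0 + n)) by (change 1 with (INR 1); apply le_INR; lia).
destruct m as [|m0].
- simpl (_ ^ 0); rewrite !Rmult_1_r; unfold Rpower; simpl INR.
  rewrite !Rmult_0_l, exp_0, Rmult_1_r, !pow_exp, <- exp_plus.
  pose proof (pos_INR p0).
  apply exp_monotone; nra.
- set (m := S m0).
  assert (Hm : 0 < INR m) by (apply lt_0_INR; unfold m; lia).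
  clearbody m.
  set (N := INR (p0 + n)) in *.
  replace (INR m / (A * Rpower N (- (1 / k)) / 2)) with
    (2 / A * (exp (ln (INR m)) * exp (1 / k * ln N))).
  2:{ rewrite exp_ln by exact Hm; unfold Rpower.
      replace (- (1 / k) * ln N) with (- (1 / k * ln N)) by ring.
      rewrite exp_Ropp; field; split; [|lra].
      pose proof (exp_pos (1 / k * ln N)); lra. }
  unfold gevrey_base, Rpower.
  rewrite !Rpow_mult_distr, !pow_exp.
  assert (Hpow : 0 < (2 / A) ^ m)
    by (apply pow_lt, Rdiv_lt_0_compat; lra).
  match goal with |- ?x * (?y * (?z * ?t)) <= ?u * (?y * ?v) * ?w * ?s =>
    replace (x * (y * (z * t))) with (y * (x * (z * t))) by ring;
    replace (u * (y * v) * w * s) with (y * (u * v * w * s)) by ring end.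
  apply Rmult_le_compat_l; [lra|].
  rewrite <- !exp_plus; apply exp_monotone.
  (* ln x <= x at the ratio of N to m / (k lam), where N^(m/k) exp (-lam N) peaks. *)
  assert (HL : ln (N * (k * lam) / INR m) <= N * (k * lam) / INR m).
  { apply ln_le_id, Rdiv_lt_0_compat; [|exact Hm].
    apply Rmult_lt_0_compat; [lra|]; now apply Rmult_lt_0_compat. }
  assert (Hkl : 0 < k * lam) by now apply Rmult_lt_0_compat.
  rewrite ln_div, ln_mult in HL; try lra; try (apply Rmult_lt_0_compat; lra).
  apply Rmult_le_compat_l with (r := INR m / k) in HL.
  2:{ unfold Rdiv; apply Rmult_le_pos; [lra|]; left; now apply Rinv_0_lt_compat. }
  replace (INR m / k * (N * (k * lam) / INR m)) with (N * lam) in HL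
    by (field; lra).
  rewrite ln_Rinv by exact Hkl.
  unfold N in HL at 2; rewrite plus_INR in HL.
  pose proof (pos_INR p0).
  replace (INR m * (1 / k * - ln (k * lam))) with (- (INR m / k * ln (k * lam)))
    by (field; lra).
  replace (INR m * (1 + 1 / k) * ln (INR m)) with
    (INR m * ln (INR m) + INR m / k * ln (INR m)) by (field; lra).
  replace (INR m * (1 / k * ln N)) with (INR m / k * ln N) by (field; lra).
  nra.
Qed.

(** Uniform second-order bounds on the terms give a second-order bound on the sum,
    which is stronger than differentiability. *)
Lemma is_derive_seg_Csum (G G1 : nat -> R -> C) (K0 K1 K2 s : R) :
  0 <= s < 1 ->
  (forall x, seg x -> dominated (fun n => G n x) K0 s) ->
  (forall x, seg x -> dominated (fun n => G1 n x) K1 s) ->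
  (forall n x y, seg x -> seg y ->
     Cmod (G n y - G n x - RtoC (y - x) * G1 n x) <= K2 * s ^ n * (y - x) ^ 2) ->
  forall x, seg x ->
    is_derive_seg (fun x => Csum (fun n => G n x)) x (Csum (fun n => G1 n x)).
Proof.
intros Hs H0 H1 H2 x Sx.
apply is_derive_seg_of_bound; [exact Sx|]; intros eps He.
assert (HK2 : 0 <= K2).
{ apply Rnot_lt_le; intros N.
  destruct (Req_dec x 1) as [E|E].
  - specialize (H2 O x (-1) Sx ltac:(unfold seg; lra)).
    pose proof (Cmod_ge_0 (G O (-1) - G O x - RtoC (-1 - x) * G1 O x)).
    simpl in H2; nra.
  - specialize (H2 O x 1 Sx ltac:(unfold seg; lra)).
    pose proof (Cmod_ge_0 (G O 1 - G O x - RtoC (1 - x) * G1 O x)).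
    assert (0 < (1 - x) ^ 2) by (apply pow2_gt_0; lra).
    simpl in H2; nra. }
set (B := 2 * K2 / (1 - s)).
assert (HB : 0 <= B) by (unfold B; apply Rdiv_le_0_compat; lra).
exists (eps / (B + 1)); split; [apply Rdiv_lt_0_compat; lra|]; intros y Sy Hy.
rewrite <- (Csum_taylor _ _ _ _ s K0 K0 K1) by auto.
destruct (Csum_dominated
  (fun n => G n y - G n x - RtoC (y - x) * G1 n x)%C (K2 * (y - x) ^ 2) s Hs)
  as [_ [_ E]].
{ intros n; apply Rle_trans with (1 := H2 n x y Sx Sy); right; ring. }
apply Rle_trans with (1 := E).
replace (2 * (K2 * (y - x) ^ 2) / (1 - s)) with (B * (y - x) ^ 2)
  by (unfold B; field; lra).
rewrite <- (pow2_abs (y - x)).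
apply Rmult_lt_compat_r with (r := B + 1) in Hy; [|lra].
replace (eps / (B + 1) * (B + 1)) with eps in Hy by (field; lra).
pose proof (Rabs_pos (y - x)); nra.
Qed.

Lemma sup_norm_le (f : R -> C) (M : R) :
  (forall x, seg x -> Cmod (f x) <= M) -> Rbar_le (sup_norm f) M.
Proof.
intros H; apply (proj2 (Lub_Rbar_correct _)); intros v [x [Sx ->]].
apply H, Sx.
Qed.

Definition gevrey_radius (k A : R) (p0 n : nat) : R :=
  A * Rpower (INR (p0 + n)) (- (1 / k)).

Lemma gevrey_radius_pos (k A : R) (p0 n : nat) : 0 < A -> 0 < gevrey_radius k A p0 n.
Proof. intros; apply Rmult_lt_0_compat; [assumption|apply exp_pos]. Qed.

Lemma gevrey_radius_decr (k A : R) (p0 n : nat) :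
  0 < k -> 0 < A -> (1 <= p0)%nat ->
  gevrey_radius k A p0 (S n) <= gevrey_radius k A p0 n <= A.
Proof.
intros Hk HA Hp; unfold gevrey_radius, Rpower.
assert (H1 : 1 <= INR (p0 + n)) by (change 1 with (INR 1); apply le_INR; lia).
assert (H2 : INR (p0 + n) <= INR (p0 + S n)) by (apply le_INR; lia).
assert (0 < 1 / k) by (apply Rdiv_lt_0_compat; lra).
assert (L1 : 0 <= ln (INR (p0 + n))).
{ rewrite <- ln_1; apply ln_le; lra. }
assert (L2 : ln (INR (p0 + n)) <= ln (INR (p0 + S n))) by (apply ln_le; lra).
split.
- apply Rmult_le_compat_l; [lra|]; apply exp_monotone; nra.
- rewrite <- (Rmult_1_r A) at 2; apply Rmult_le_compat_l; [lra|].
  apply Rle_trans with (exp 0); [apply exp_monotone; nra|rewrite exp_0; lra].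
Qed.

(** The limit is written as the series of the differences f_{n+1} - f_n, whose
    derivatives of all orders are summed separately; [Y m] is the m-th derivative
    of the limit.  Keeping the rate of convergence of f_n and of its derivative
    allows one to pass to the limit in a differential equation. *)
Theorem gevrey_limit (k A r q : R) (p0 : nat) (f : nat -> C -> C) :
  0 < k -> 0 < A -> 0 < r -> 0 < q < 1 -> (1 <= p0)%nat ->
  (forall n z, seg_nbhd (gevrey_radius k A p0 n) z ->
     cdiff (f n) z /\ Cmod (f n z) <= r) ->
  (forall n z, seg_nbhd (gevrey_radius k A p0 (S n)) z ->
     Cmod (f (S n) z - f n z) <= 2 * r * q ^ n) ->
  exists (Y : nat -> R -> C) (K s : R), 0 <= s < 1 /\
    gevrey k (Y O) /\
    (forall x, seg x -> is_derive_seg (Y O) x (Y 1%nat x)) /\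
    (forall n x, seg x -> Cmod (Y O x - f n (RtoC x)) <= K * s ^ n) /\
    (forall n x, seg x -> Cmod (Y 1%nat x - C_derive (f n) (RtoC x)) <= K * s ^ n).
Proof.
intros Hk HA Hr Hq Hp0 Hf Hdiff.
set (rho := gevrey_radius k A p0) in *.
assert (Hrho : forall n, 0 < rho n) by (intros; now apply gevrey_radius_pos).
assert (Hdec : forall n, rho (S n) <= rho n)
  by (intros n; apply gevrey_radius_decr; assumption).
set (lam := - ln q / 2).
assert (Hlam : 0 < lam).
{ assert (ln q < ln 1) by (apply ln_increasing; lra).
  rewrite ln_1 in *; unfold lam; lra. }
assert (Eq : exp (- 2 * lam) = q).
{ unfold lam; replace (-2 * (- ln q / 2)) with (ln q) by field.
  apply exp_ln; lra. }
set (s := exp (- lam)).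
assert (Hs : 0 <= s < 1).
{ split; [left; apply exp_pos|]; rewrite <- exp_0; apply exp_increasing; lra. }
set (g := fun n z => match n with
                     | O => f O z
                     | S m => (f (S m) z - f m z)%C
                     end).
set (D := 2 * r / q).
assert (HD : 0 < D) by (apply Rdiv_lt_0_compat; lra).
assert (Hg : forall n z, seg_nbhd (rho n) z ->
   cdiff (g n) z /\ Cmod (g n z) <= D * q ^ n).
{ intros [|n] z Uz.
  - destruct (Hf O z Uz) as [F1 F2]; split; [exact F1|].
    change (g O z) with (f O z); apply Rle_trans with (1 := F2).
    unfold D; apply Rmult_le_reg_r with q; [lra|].
    replace (2 * r / q * q ^ 0 * q) with (2 * r) by (simpl; field; lra); nra.
  - assert (Uz' := seg_nbhd_le _ _ _ (Hdec n) Uz).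
    destruct (Hf _ z Uz) as [[l1 F1] _]; destruct (Hf _ z Uz') as [[l2 F2] _].
    split; [exists (l1 - l2)%C; exact (is_cderive_minus _ _ _ _ _ F1 F2)|].
    apply Rle_trans with (1 := Hdiff n z Uz).
    unfold D; right; simpl; field; lra. }
set (G := fun (m n : nat) (x : R) => C_derive_n m (g n) (RtoC x)).
set (E := D * exp (2 * lam) ^ p0).
assert (HE : 0 < E).
{ apply Rmult_lt_0_compat; [exact HD|]; apply pow_lt, exp_pos. }
set (Kd := fun m => E * (gevrey_base k A lam ^ m
                          * Rpower (INR m) (INR m * (1 + 1 / k)))).
assert (HG : forall m x, seg x -> dominated (fun n => G m n x) (Kd m) s).
{ intros m x Sx n; unfold G.
  apply Rle_trans with (D * q ^ n * (INR m / (rho n / 2)) ^ m).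
  - specialize (Hrho n).
    apply (C_derive_n_bound (seg_nbhd (rho n))); [apply seg_nbhd_open|apply Hg|lra|].
    intros w Hw.
    enough (U : seg_nbhd (rho n) w) by (split; [exact U|apply Hg, U]).
    exists x, (w - RtoC x)%C; split; [exact Sx|]; split; [lra|ring].
  - rewrite Rmult_assoc; unfold Kd, E, s.
    rewrite !(Rmult_assoc D); apply Rmult_le_compat_l; [lra|].
    rewrite <- Eq; unfold rho, gevrey_radius.
    apply Rle_trans with (1 := gevrey_term_bound k A lam p0 n m Hk HA Hlam Hp0).
    right; ring. }
assert (HGd : forall m n x, seg x -> cdiff (C_derive_n m (g n)) (RtoC x)).
{ intros m n x Sx.
  apply (C_derive_n_differentiable (seg_nbhd (rho n)));
    [apply seg_nbhd_open|apply Hg|now apply seg_nbhd_RtoC]. }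
assert (Hconv : forall x y t, seg x -> seg y -> 0 <= t <= 1 ->
   (RtoC x + RtoC t * RtoC (y - x))%C = RtoC (x + t * (y - x)) /\
   seg (x + t * (y - x))).
{ intros x y t Sx Sy Ht; split; [now rewrite RtoC_plus, RtoC_mult|].
  unfold seg in *; nra. }
assert (HGt : forall m n x y, seg x -> seg y ->
   Cmod (G m n y - G m n x - RtoC (y - x) * G (S m) n x)
     <= Kd (S (S m)) * s ^ n * (y - x) ^ 2).
{ intros m n x y Sx Sy; unfold G.
  pose proof (taylor1_bound (C_derive_n m (g n)) (RtoC x) (RtoC (y - x))
    (Kd (S (S m)) * s ^ n)) as T.
  replace (RtoC x + RtoC (y - x))%C with (RtoC y) in T
    by (rewrite RtoC_minus; ring).
  rewrite Cmod_R, pow2_abs in T.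
  rewrite (Cmult_comm (RtoC (y - x))).
  apply T.
  { apply Rle_trans with (2 := HG (S (S m)) x Sx n), Cmod_ge_0. }
  intros t Ht; destruct (Hconv x y t Sx Sy Ht) as [-> St].
  set (v := x + t * (y - x)) in *; split; [now apply HGd|].
  apply Rle_trans with (Kd (S (S m)) * s ^ n * Cmod (RtoC v - RtoC x)).
  - apply (Cmod_mean_value (C_derive_n (S m) (g n))); intros t' Ht'.
    rewrite <- RtoC_minus.
    destruct (Hconv x v t' Sx St Ht') as [-> St'].
    exists (G (S (S m)) n (x + t' * (v - x))); split.
    + apply (is_cderive_C_derive (C_derive_n (S m) (g n))), HGd, St'.
    + apply HG, St'.
  - apply Rmult_le_compat_l.
    { apply Rle_trans with (2 := HG (S (S m)) x Sx n), Cmod_ge_0. }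
    rewrite <- RtoC_minus, Cmod_R; unfold v.
    replace (x + t * (y - x) - x) with (t * (y - x)) by ring.
    rewrite Rabs_mult, Rabs_pos_eq by lra.
    pose proof (Rabs_pos (y - x)); nra. }
set (Y := fun m x => Csum (fun n => G m n x)).
assert (HY : forall m x, seg x -> is_derive_seg (Y m) x (Y (S m) x)).
{ intros m; apply (is_derive_seg_Csum (G m) (G (S m)) (Kd m) (Kd (S m))
    (Kd (S (S m))) s Hs); auto. }
assert (Hs' : 0 < / (1 - s)) by (apply Rinv_0_lt_compat; lra).
assert (HKd : forall m, 0 <= Kd m).
{ intros m; pose proof (HG m 0 ltac:(unfold seg; lra) O) as B; simpl in B.
  pose proof (Cmod_ge_0 (G m O 0)); lra. }
set (K := 2 * Kd 0%nat / (1 - s) + 2 * Kd 1%nat / (1 - s)).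
assert (HK0 : 0 <= 2 * Kd 0%nat / (1 - s)).
{ unfold Rdiv; specialize (HKd 0%nat); nra. }
assert (HK1 : 0 <= 2 * Kd 1%nat / (1 - s)).
{ unfold Rdiv; specialize (HKd 1%nat); nra. }
exists Y, K, s; split; [exact Hs|]; split; [|split; [apply HY|split]].
- exists Y; split; [split; [reflexivity|exact HY]|].
  set (E' := 2 * E / (1 - s)).
  assert (HE' : 0 < E') by (unfold E', Rdiv; apply Rmult_lt_0_compat; lra).
  assert (HB0 : 0 < gevrey_base k A lam).
  { apply Rmult_lt_0_compat; [apply Rdiv_lt_0_compat; lra|apply exp_pos]. }
  exists (E' + gevrey_base k A lam); split; [lra|]; intros m.
  apply sup_norm_le; intros x Sx.
  destruct (Csum_dominated _ _ _ Hs (HG m x Sx)) as [_ [_ B]].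
  apply Rle_trans with (1 := B).
  replace (2 * Kd m / (1 - s)) with
    (E' * gevrey_base k A lam ^ m * Rpower (INR m) (INR m * (1 + 1 / k)))
    by (unfold E', Kd, Rdiv; ring).
  apply Rmult_le_compat_r; [left; apply exp_pos|]; simpl.
  apply Rmult_le_compat; [lra|apply pow_le; lra|lra|apply pow_incr; lra].
- intros n x Sx.
  apply Rle_trans with (2 * Kd 0%nat / (1 - s) * s ^ n).
  + apply (Csum_tail (fun n => G O n x) (fun n => f n (RtoC x)) _ s Hs (HG O x Sx));
      reflexivity.
  + apply Rmult_le_compat_r; [apply pow_le; lra|unfold K; lra].
- intros n x Sx.
  apply Rle_trans with (2 * Kd 1%nat / (1 - s) * s ^ n).
  + apply (Csum_tail (fun n => G 1%nat n x) (fun n => C_derive (f n) (RtoC x))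
      _ s Hs (HG 1%nat x Sx)); [reflexivity|].
    intros m; apply is_C_derive_unique.
    apply is_cderive_minus; apply is_cderive_C_derive, Hf, seg_nbhd_RtoC; auto.
  + apply Rmult_le_compat_r; [apply pow_le; lra|unfold K; lra].
Qed.

(** * The solution *)

Theorem theorem3p1
  (k : R) (hk : 0 < k)
  (mu : R) (hmu : 0 < mu)
  (a b psi : C -> C)
  (ha : holomorphic_on (seg_nbhd mu) a)
  (hb : holomorphic_on (seg_nbhd mu) b)
  (hpsi : holomorphic_on (seg_nbhd mu) psi)
  (hE : E_property k mu psi)
  (d : R) (hd : seg d) (c : R)
  (coef : nat -> R) (N0 : nat) (hN0 : (2 <= N0)%nat) (hdeg : coef N0 <> 0)
  (h0 : norm1 a * Derive (poly_under coef N0) 0 < 1)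
  (theta : R)
  (htheta : unique
     (fun r : R => 0 < r /\ norm1 a * Derive (poly_under coef N0) r = 1) theta)
  (hlt : 0 < norm1 (fun z : C => Cplus (b z) (Cmult (poly_eval coef N0 (RtoC 0)) (a z)))
             + Rabs c
           < theta - poly_under coef N0 theta / Derive (poly_under coef N0) theta) :
  exists u : R -> C,
    gevrey k u /\
    is_solution a b psi (poly_eval coef N0) u /\
    u d = RtoC c.
Proof.
set (P := poly_eval coef N0) in *.
set (g0 := fun z : C => Cplus (b z) (Cmult (P (RtoC 0)) (a z))) in *.
assert (Smu : forall t, seg t -> seg_nbhd mu (RtoC t))
  by (intros; now apply seg_nbhd_RtoC).
assert (Hg0 : forall z, seg_nbhd mu z -> cdiff g0 z).
{ intros z Uz; destruct (ha z Uz) as [la Hla]; destruct (hb z Uz) as [lb Hlb].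
  eexists; apply is_cderive_plus; [exact Hlb|].
  apply (is_cderive_mult (fun _ => P (RtoC 0))); [apply is_cderive_const|exact Hla]. }
pose proof (norm1_nonneg a (fun t St => ha _ (Smu t St))) as Hna.
destruct htheta as [[Htheta Hth1] _].
destruct (choose_radius (norm1 a) (norm1 g0 + Rabs c) theta coef N0)
  as [r [Hr [Hself Hcontr]]]; try assumption; [apply hlt|].
set (Qr := poly_under coef N0 r) in *; set (Q'r := poly_under_deriv coef N0 r) in *.
assert (HQ : 0 <= Qr) by (apply poly_under_nonneg; lra).
assert (HQ' : 0 <= Q'r) by (apply (poly_under_deriv_le coef N0 r r); lra).
destruct (bounded_near_seg mu a hmu ha) as [ra [Ka [Hra HKa]]].
destruct (bounded_near_seg mu g0 hmu Hg0) as [rg [Kg [Hrg HKg]]].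
assert (PKa : 0 <= Ka).
{ apply Rle_trans with (1 := Cmod_ge_0 (a (RtoC d))), HKa, seg_nbhd_RtoC; tauto. }
assert (PKg : 0 <= Kg).
{ apply Rle_trans with (1 := Cmod_ge_0 (g0 (RtoC d))), HKg, seg_nbhd_RtoC; tauto. }
destruct hE as [tau [Htau HE]].
set (q := (1 + norm1 a * Q'r) / 2).
assert (Hq0 : 0 <= norm1 a * Q'r) by now apply Rmult_le_pos.
assert (Hq : 0 < q < 1) by (unfold q; lra).
(* The gaps in the two strict inequalities at r determine how small A must be. *)
set (A1 := (r - (norm1 g0 + Rabs c + norm1 a * Qr)) / (Kg + Ka * Qr + 1)).
set (A2 := (q - norm1 a * Q'r) / (Ka * Q'r + 1)).
assert (D1 : 0 <= Kg + Ka * Qr) by (pose proof (Rmult_le_pos _ _ PKa HQ); lra).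
assert (D2 : 0 <= Ka * Q'r) by now apply Rmult_le_pos.
assert (HA1 : 0 < A1) by (apply Rdiv_lt_0_compat; lra).
assert (HA2 : 0 < A2) by (apply Rdiv_lt_0_compat; unfold q in *; lra).
set (A := Rmin tau (Rmin (Rmin ra rg) (Rmin A1 A2))).
assert (HA : 0 < A) by (repeat apply Rmin_pos; lra).
assert (LA : A <= tau /\ A <= ra /\ A <= rg /\ A <= A1 /\ A <= A2).
{ unfold A, Rmin; repeat destruct Rle_dec; lra. }
clearbody A; destruct LA as [LA1 [LA2 [LA3 [LA4 LA5]]]].
assert (LA : A <= mu) by lra.
destruct (HE A (conj HA LA1)) as [p0 [Hp0 HEp]].
destruct (picard_sequence a b psi coef N0 d c A Ka Kg r q (gevrey_radius k A p0))
  as [f [Hf1 [Hf2 [Hf3 Hf4]]]]; try assumption; try lra.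
{ intros n; split; [now apply gevrey_radius_pos|now apply gevrey_radius_decr]. }
{ intros n; now apply gevrey_radius_decr. }
{ intros z Uz; apply seg_nbhd_le with (1 := LA) in Uz.
  split; [now apply ha|split; [now apply hb|now apply hpsi]]. }
{ intros n z Uz; apply (HEp (p0 + n)%nat); [lia|].
  unfold seg_nbhd_k; replace (S (p0 + n)) with (p0 + S n)%nat by lia; exact Uz. }
{ intros z Uz; split; [apply HKa|apply HKg]; now apply seg_nbhd_le with (2 := Uz). }
{ fold P g0 Qr.
  apply Rmult_le_compat_r with (r := Kg + Ka * Qr + 1) in LA4; [|lra].
  unfold A1 in LA4; unfold Rdiv in LA4; rewrite Rmult_assoc, Rinv_l in LA4 by lra.
  lra. }
{ fold Q'r.
  apply Rmult_le_compat_r with (r := Ka * Q'r + 1) in LA5; [|lra].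
  unfold A2 in LA5; unfold Rdiv in LA5; rewrite Rmult_assoc, Rinv_l in LA5 by lra.
  lra. }
destruct (gevrey_limit k A r q p0 f) as [Y [K [s [Hs [HY [HY1 [HY2 HY3]]]]]]];
  try assumption.
assert (Hlim0 : forall z : C, (forall n, Cmod z <= K * s ^ n) -> z = RtoC 0).
{ intros z Hz; apply Cmod_eq_0, Rle_antisym; [|apply Cmod_ge_0].
  now apply le_0_of_geometric with K s. }
exists (Y O); split; [exact HY|]; split.
- intros x Sx.
  destruct (E_property_seg k mu psi x hk) as [t [St Et]]; [now exists tau|exact Sx|].
  rewrite Et; change (Re (RtoC t)) with t.
  replace (a (RtoC x) * P (Y O t) + b (RtoC x))%C with (Y 1%nat x); [now apply HY1|].
  set (v := Y O t); set (M := Rmax r (Cmod v)).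
  assert (HM : 0 <= poly_under_deriv coef N0 M).
  { apply (poly_under_deriv_le coef N0 M M).
    pose proof (Rmax_l r (Cmod v)); unfold M; lra. }
  (* Both sides are limits, at a geometric rate, of the two sides of the equation
     satisfied by the iterates. *)
  enough (Z : (Y 1%nat x - (a (RtoC x) * P v + b (RtoC x)))%C = RtoC 0).
  { replace (Y 1%nat x) with ((Y 1%nat x - (a (RtoC x) * P v + b (RtoC x)))
      + (a (RtoC x) * P v + b (RtoC x)))%C by ring.
    rewrite Z; ring. }
  apply Cmod_eq_0, Rle_antisym; [|apply Cmod_ge_0].
  apply le_0_of_geometric with
    (K * s + Cmod (a (RtoC x)) * poly_under_deriv coef N0 M * K) s; [exact Hs|].
  intros n.
  assert (F : C_derive (f (S n)) (RtoC x) =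
     (a (RtoC x) * P (f n (RtoC t)) + b (RtoC x))%C).
  { rewrite <- Et; apply is_C_derive_unique, Hf2, seg_nbhd_RtoC; [|exact Sx].
    now apply gevrey_radius_pos. }
  replace (Y 1%nat x - (a (RtoC x) * P v + b (RtoC x)))%C with
    ((Y 1%nat x - C_derive (f (S n)) (RtoC x))
      + a (RtoC x) * (P (f n (RtoC t)) - P v))%C by (rewrite F; ring).
  apply Rle_trans with (1 := Cmod_triangle _ _); rewrite Cmod_mult.
  pose proof (HY3 (S n) x Sx) as B1; simpl in B1.
  pose proof (HY2 n t St) as B2; fold v in B2; rewrite Cmod_opp_minus in B2.
  assert (B3 : Cmod (P (f n (RtoC t)) - P v)
            <= poly_under_deriv coef N0 M * Cmod (f n (RtoC t) - v)).
  { apply poly_eval_lipschitz; [|apply Rmax_r].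
    apply Rle_trans with (2 := Rmax_l _ _), Hf1, seg_nbhd_RtoC; [|exact St].
    now apply gevrey_radius_pos. }
  apply Rmult_le_compat_l with (r := poly_under_deriv coef N0 M) in B2; [|exact HM].
  assert (B4 := Rle_trans _ _ _ B3 B2).
  apply Rmult_le_compat_l with (r := Cmod (a (RtoC x))) in B4; [|apply Cmod_ge_0].
  lra.
- enough (Z : (Y O d - RtoC c)%C = RtoC 0).
  { replace (Y O d) with ((Y O d - RtoC c) + RtoC c)%C by ring.
    rewrite Z; ring. }
  apply Hlim0; intros n; rewrite <- (Hf4 n); now apply HY2.
Qed.
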